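(* Let $\Omega \subset \mathbb{C}^d$ be a domain which satisfies the star condition and let $V\subset\Omega$ be a bounded open set. Let $X(\Omega,V)=\{f\in H(\Omega): f|_V\text{ is bounded}\}$. Then $\Omega$ is an $X(\Omega,V)$-domain of holomorphy.
   Context: A domain is a nonempty open connected set, $d\ge 1$; $H(\Omega)$ is the set of holomorphic functions $\Omega\to\mathbb{C}$. Star condition: an open connected set $\Omega\subset\mathbb{C}^d$ satisfies the star condition if for every $\zeta\in\partial\Omega$ there exist points $w\in\mathbb{C}^d\setminus\overline{\Omega}$ arbitrarily close to $\zeta$, each with a non-zero vector $v\in\mathbb{C}^d$ such that the $(d-1)$-dimensional complex hyperplane $H=w+\{v\}^{\perp}=\{z\in\mathbb{C}^d:\langle z,v\rangle=\langle w,v\rangle\}$ does not intersect $\overline{\Omega}$. A holomorphic function $f:\Omega\to\mathbb{C}$ is extendable if there exist an open connected set $U\subset\mathbb{C}^d$ with $U\cap\Omega\neq\emptyset$ and $U\cap\Omega^{\mathrm c}\neq\emptyset$, a holomorphic function $F:U\to\mathbb{C}$ and a connected component $W$ of $U\cap\Omega$ such that $F|_W=f|_W$. Otherwise $f$ is non-extendable. For $X\subset H(\Omega)$, $\Omega$ is called an $X$-domain of holomorphy if there exists $f\in X$ which is non-extendable. *)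

(* Defs.v *)
From mathcomp Require Import all_boot all_order all_algebra.
From mathcomp Require Import complex.
From mathcomp Require Import all_classical all_reals all_analysis.

Set Implicit Arguments.
Unset Strict Implicit.
Unset Printing Implicit Defensive.

Import Order.TTheory GRing.Theory Num.Theory.
Import numFieldNormedType.Exports.

Local Open Scope classical_set_scope.
Local Open Scope ring_scope.

(* [complex R] carries no topology of its own; packing it as a
   [numClosedFieldType] gives it the norm topology of its modulus and makes it
   the scalar field of [Cspace], so that [differentiable] below is complex
   (C-linear Fréchet) differentiability. The library norm on row vectors is the
   sup norm, which induces the usual topology and bounded sets of C^d. *)
Definition Cfield (R : realType) : numClosedFieldType := complex R.

Definition Cspace (R : realType) (d : nat) : normedModType (Cfield R) :=
  'rV[Cfield R]_d.

Definition domain (R : realType) (d : nat) (Omega : set (Cspace R d)) : Prop :=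
  [/\ open Omega, Omega !=set0 & connected Omega].

Definition boundary (T : topologicalType) (A : set T) : set T :=
  closure A `\` interior A.

Definition hyperplane (R : realType) (d : nat) (w v : Cspace R d) :
    set (Cspace R d) :=
  [set z | dotmx z v = dotmx w v].

Definition star_condition (R : realType) (d : nat) (Omega : set (Cspace R d)) :
    Prop :=
  forall zeta, boundary Omega zeta ->
  forall N, nbhs zeta N ->
  exists w, [/\ N w, ~ closure Omega w &
    exists v, v != 0 /\ hyperplane w v `&` closure Omega = set0].

(* A holomorphic function on an open set [U] is represented by a total function
   whose values outside [U] are irrelevant. *)
Definition holomorphic (R : realType) (d : nat) (U : set (Cspace R d)) :
    set (Cspace R d -> Cfield R) :=
  [set f | forall z, U z -> differentiable f z].

Definition is_component (T : topologicalType) (A W : set T) : Prop :=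
  exists2 x, A x & W = connected_component A x.

Definition extendable (R : realType) (d : nat) (Omega : set (Cspace R d))
    (f : Cspace R d -> Cfield R) : Prop :=
  exists (U : set (Cspace R d)) (F : Cspace R d -> Cfield R)
         (W : set (Cspace R d)),
    [/\ open U /\ connected U,
        U `&` Omega !=set0 /\ U `&` ~` Omega !=set0,
        holomorphic U F,
        is_component (U `&` Omega) W &
        {in W, F =1 f}].

Definition domain_of_holomorphy (R : realType) (d : nat)
    (Omega : set (Cspace R d)) (X : set (Cspace R d -> Cfield R)) : Prop :=
  exists f, X f /\ ~ extendable Omega f.

Definition holomorphic_bounded_on (R : realType) (d : nat)
    (Omega V : set (Cspace R d)) : set (Cspace R d -> Cfield R) :=
  [set f | holomorphic Omega f /\ [bounded f z | z in V]].

(* Main.v *)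
Require Import Defs.
From HB Require Import structures.
From mathcomp Require Import all_boot all_order all_algebra.
From mathcomp Require Import complex.
From mathcomp Require Import all_classical all_reals all_analysis.
From mathcomp Require Import ring lra.
Import Order.TTheory GRing.Theory Num.Theory.
Import numFieldNormedType.Exports.
Local Open Scope classical_set_scope.
Local Open Scope ring_scope.

Set Implicit Arguments.
Unset Strict Implicit.
Unset Printing Implicit Defensive.

(** The star condition provides many explicit singular functions.  If the
    hyperplane [w + v^perp] misses the closure of [Omega], then
    [z |-> c / <z - w, v>] is holomorphic on [Omega], and it is bounded on the
    bounded set [V] because its denominator has no zero on the compact closure
    of [V].  For every pair of a rational point [q] of [Omega] and a radius
    [sigma = 1 / (j + 1)] such that the ball [B(q, sigma)] meets the boundary,
    [exists_singular_function] gives such a function whose pole hyperplane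
    meets [B(q, sigma)], scaled to be at most 1 on [V] and at most [1 / rho] at
    the centre of every ball of radius [rho] inside [Omega].  Listing each of
    these countably many functions infinitely often, with weights [2^-n], every
    set [S] of indices yields a sum [subseries S] that is holomorphic on
    [Omega] and bounded on [V].  It remains to see that a generic [S] gives a
    function without extension.

    Suppose that [F] extends [subseries S].  Connectedness of its domain gives
    a boundary point [zeta] of [Omega] that is adherent to the component [W] on
    which [F] and the sum agree ([component_boundary_point]), and [F] is
    bounded by some [M] on a ball [B(zeta, r)].  Choose [sigma < r / 5], a
    rational point [q] of [W] with [|q - zeta| < sigma], and a point [w] of the
    corresponding pole hyperplane in [B(q, sigma)].  On the complex line
    [q + lambda (w - q)] each term of the sum has the form
    [d_n / (1 - lambda b_n)], so the Taylor coefficients at [lambda = 0] are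
    the sums of [S_n d_n b_n ^ m], whereas [F] is holomorphic and bounded by
    [M] for [|lambda| <= 4].  This forces the [m]-th coefficient to be at most
    [M / 2 ^ m] ([taylor_coefficient_le]).  But [b_n = 1] for the infinitely
    many indices [n] whose pole is [w]: changing a single such bit of [S]
    changes all the coefficients by the same nonzero number.  A Baire category
    argument in Cantor space ([exists_bits_unbounded]) therefore produces an
    [S] that violates the bound for every [q], [sigma] and [M].

    The bound on Taylor coefficients comes from the inequality
    [|phi(0)| <= max |phi|] over a circle ([modulus_center_le]), applied after
    dividing repeatedly by [lambda]; every division loses a factor 2, which the
    radius 4 absorbs.  The functions at hand are only known to be complex
    differentiable at each point, hence this inequality needs Goursat's
    bisection argument.  It is carried out on rectangles in polar coordinates
    for the real part of [phi dlambda / (i lambda)], with primitives of the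
    sides instead of integrals: the means of [Re phi] over concentric circles
    coincide, so [Re phi] takes a common value on any two of them
    ([Re_common_value_on_circles]). *)

(** * Additive functions of rectangles *)

Lemma exists_half_pow_lt (R : realType) (c e : R) : 0 < e ->
  exists N, forall n, (N <= n)%N -> c * 2^-1 ^+ n < e.
Proof.
move=> e0; have : (fun n => c * (2^-1 : R) ^+ n) @ \oo --> (c * 0 : R).
  by apply: cvgMr; apply: cvg_expr; rewrite ger0_norm//; lra.
rewrite mulr0 => /cvgrPdist_lt/(_ _ e0)[N _ NP]; exists N => n /NP /=.
by rewrite sub0r normrN; exact: le_lt_trans (ler_norm _).
Qed.

Lemma recursive_choice (T : Type) (P : nat -> T -> Prop)
    (Q : nat -> T -> T -> Prop) (t : T) :
  P 0%N t -> (forall n x, P n x -> exists y, P n.+1 y /\ Q n x y) ->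
  exists c : nat -> T, c 0%N = t /\ forall n, P n (c n) /\ Q n (c n) (c n.+1).
Proof.
move=> Pt step.
have next n x : {y | P n x -> P n.+1 y /\ Q n x y}.
  by apply: cid; have [/step[y]|] := pselect (P n x); [exists y|exists x].
pose c := nat_rect (fun=> T) t (fun n x => sval (next n x)).
exists c; split=> //.
have cP n : P n (c n).
  by elim: n => // n IH; have [] := svalP (next n (c n)) IH.
by move=> n; split=> //; have [] := svalP (next n (c n)) (cP n).
Qed.

Lemma nested_intervals_inhabited (R : realType) (a δ : nat -> R) :
  (forall n, 0 <= δ n) ->
  (forall n, a n <= a n.+1) -> (forall n, a n.+1 + δ n.+1 <= a n + δ n) ->
  exists p, forall n, a n <= p <= a n + δ n.
Proof.
move=> δ0 aS bS.
have aD n k : a n <= a (n + k)%N.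
  by elim: k => [|k]; rewrite ?addn0// addnS => /le_trans; apply.
have bD n k : a (n + k)%N + δ (n + k)%N <= a n + δ n.
  by elim: k => [|k IH]; rewrite ?addn0// addnS; apply: le_trans IH.
have ab n m : a n <= a m + δ m.
  apply: le_trans (aD n m) _; rewrite addnC; apply: le_trans (bD m n).
  by rewrite lerDl.
have hs : has_sup (range a).
  by split; [exists (a 0%N), 0%N | exists (a 0%N + δ 0%N) => _ [n _ <-]].
exists (sup (range a)) => n; apply/andP; split.
  by apply: sup_upper_bound => //; exists n.
by apply: ge_sup => [|_ [m _ <-]]; [exists (a 0%N), 0%N|].
Qed.

(** Goursat's bisection.  If [J] did not vanish on the whole rectangle, one of
    its four quarters would carry at least a quarter of the value, and so on;
    the nested quarters shrink to a point where [J] decays no faster than the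
    area, against the assumption of being [o(diameter ^ 2)]. *)
Lemma additive_small_rectangle_function_eq0 (R : realType)
    (J : R -> R -> R -> R -> R) (x0 x1 y0 y1 : R) :
  (forall a b c p q, J a c p q = J a b p q + J b c p q) ->
  (forall a b p q r, J a b p r = J a b p q + J a b q r) ->
  x0 <= x1 -> y0 <= y1 ->
  (forall x y, x0 <= x <= x1 -> y0 <= y <= y1 -> forall e, 0 < e ->
    exists2 δ, 0 < δ & forall a b p q,
      x0 <= a -> a <= x <= b -> b <= x1 -> y0 <= p -> p <= y <= q -> q <= y1 ->
      b - a < δ -> q - p < δ -> `|J a b p q| <= e * ((b - a) + (q - p)) ^+ 2) ->
  J x0 x1 y0 y1 = 0.
Proof.
move=> addx addy x01 y01 loc; apply/eqP/contraT; rewrite -normr_gt0 => κ0.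
set κ := `|_| in κ0.
pose w n : R := (x1 - x0) * 2^-1 ^+ n; pose h n : R := (y1 - y0) * 2^-1 ^+ n.
have w0 n : 0 <= w n by rewrite mulr_ge0 ?exprn_ge0// subr_ge0.
have h0 n : 0 <= h n by rewrite mulr_ge0 ?exprn_ge0// subr_ge0.
have wS n : w n = w n.+1 + w n.+1 by rewrite /w exprS; lra.
have hS n : h n = h n.+1 + h n.+1 by rewrite /h exprS; lra.
(* [c] is the lower left corner of a rectangle of the [n]-th generation *)
pose big n (c : R * R) :=
  κ * 4^-1 ^+ n <= `|J c.1 (c.1 + w n) c.2 (c.2 + h n)|.
pose sub n (c c' : R * R) := [/\ c.1 <= c'.1, c'.1 + w n.+1 <= c.1 + w n,
   c.2 <= c'.2 & c'.2 + h n.+1 <= c.2 + h n].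
have step n c : big n c -> exists c', big n.+1 c' /\ sub n c c'.
  rewrite /big /sub wS hS; case: c => a p /=.
  have := w0 n.+1; have := h0 n.+1.
  set u := w n.+1; set v := h n.+1 => v0 u0 B.
  apply: contrapT => no.
  have lt a' p' : (a' = a \/ a' = a + u) -> (p' = p \/ p' = p + v) ->
      `|J a' (a' + u) p' (p' + v)| < κ * 4^-1 ^+ n.+1.
    move=> ha hp; rewrite ltNge; apply/negP => B'; apply: no.
    by exists (a', p'); split => //=; case: ha => ->; case: hp => ->; split; lra.
  have L1 := lt a p (or_introl erefl) (or_introl erefl).
  have L2 := lt (a + u) p (or_intror erefl) (or_introl erefl).
  have L3 := lt a (p + v) (or_introl erefl) (or_intror erefl).
  have L4 := lt (a + u) (p + v) (or_intror erefl) (or_intror erefl).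
  have : `|J a (a + u + u) p (p + v + v)| < κ * 4^-1 ^+ n.
    rewrite (addx a (a + u) (a + u + u)) !(addy _ _ p (p + v) (p + v + v)).
    apply: le_lt_trans (ler_normD _ _) _.
    apply: le_lt_trans (lerD (ler_normD _ _) (ler_normD _ _)) _.
    move: L1 L2 L3 L4; rewrite exprS.
    by clear; move=> *; lra.
  by rewrite ltNge -!addrA B.
have [c [c0 cP]] : exists c : nat -> R * R, c 0%N = (x0, y0) /\
    forall n, big n (c n) /\ sub n (c n) (c n.+1).
  apply: (@recursive_choice _ big sub) => //.
  rewrite /big /=.
  have -> : x0 + w 0%N = x1 by rewrite /w expr0; ring.
  have -> : y0 + h 0%N = y1 by rewrite /h expr0; ring.
  by rewrite expr0 mulr1.
have [x xP] : exists x, forall n, (c n).1 <= x <= (c n).1 + w n.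
  by apply: nested_intervals_inhabited => // n; have [_ []] := cP n.
have [y yP] : exists y, forall n, (c n).2 <= y <= (c n).2 + h n.
  by apply: nested_intervals_inhabited => // n; have [_ []] := cP n.
have inx n : x0 <= (c n).1 /\ (c n).1 + w n <= x1.
  elim: n => [|n [IH1 IH2]].
    by rewrite c0 /w /= expr0; split; lra.
  by have [_ [le1 le2 _ _]] := cP n; split; [exact: le_trans le1|exact: le_trans IH2].
have iny n : y0 <= (c n).2 /\ (c n).2 + h n <= y1.
  elim: n => [|n [IH1 IH2]].
    by rewrite c0 /h /= expr0; split; lra.
  by have [_ [_ _ le1 le2]] := cP n; split; [exact: le_trans le1|exact: le_trans IH2].
have xin : x0 <= x <= x1.
  by move: (xP 0%N); rewrite c0 /w expr0 /=; lra.
have yin : y0 <= y <= y1.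
  by move: (yP 0%N); rewrite c0 /h expr0 /=; lra.
pose s := (x1 - x0) + (y1 - y0) + 1.
have s0 : 0 < s by rewrite /s; lra.
(* this constant makes the local bound at most half of [κ / 4 ^ n] *)
have e0 : 0 < κ / (2 * s ^+ 2) by rewrite divr_gt0// mulr_gt0// exprn_gt0.
have [δ δ0 δP] := loc x y xin yin _ e0.
have [n /(_ n (leqnn n)) nδ] := exists_half_pow_lt s δ0.
have t0 : 0 <= (2^-1 : R) ^+ n by rewrite exprn_ge0.
have wδ : w n < δ.
  apply: le_lt_trans nδ; rewrite /w ler_wpM2r// /s; lra.
have hδ : h n < δ.
  apply: le_lt_trans nδ; rewrite /h ler_wpM2r// /s; lra.
have [Bn _] := cP n; have [ix1 ix2] := inx n; have [iy1 iy2] := iny n.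
move: (δP _ _ _ _ ix1 (xP n) ix2 iy1 (yP n) iy2).
have addKl u v : u + v - u = v :> R by ring.
rewrite !addKl => /(_ wδ hδ) small.
have := le_trans Bn small; rewrite leNgt => /negP; case.
have -> : w n + h n = (s - 1) * 2^-1 ^+ n by rewrite /w /h /s; ring.
have -> : (4^-1 : R) ^+ n = (2^-1 ^+ n) ^+ 2.
  by rewrite exprAC; congr (_ ^+ n); field.
rewrite exprMn mulrA ltr_pM2r; last by rewrite !exprn_gt0// invr_gt0.
rewrite mulrAC ltr_pdivrMr ?mulr_gt0 ?exprn_gt0// ltr_pM2l//.
have : (s - 1) ^+ 2 <= s ^+ 2 by rewrite lerXn2r ?nnegrE//; rewrite /s; lra.
have : 0 < s ^+ 2 by rewrite exprn_gt0.
lra.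
Qed.

(** * Real-valued modulus *)

(** The norm of a normed module over [Cfield R] takes its values in [Cfield R],
    whose order is partial; its real part carries the same information in a
    totally ordered field. *)
Definition modulus (R : realType) (V : normedModType (Cfield R)) (v : V) : R :=
  complex.Re `|v|.

Definition toC (R : realType) (x : R) : Cfield R := Complex x 0.

Lemma toC_le (R : realType) (x y : R) : (toC x <= toC y) = (x <= y).
Proof. exact: lecR. Qed.

Lemma toC_lt (R : realType) (x y : R) : (toC x < toC y) = (x < y).
Proof. exact: ltcR. Qed.

Lemma toCD (R : realType) (x y : R) : toC (x + y) = toC x + toC y.
Proof. exact: (rmorphD (real_complex R)). Qed.

Lemma toCM (R : realType) (x y : R) : toC (x * y) = toC x * toC y.
Proof. exact: (rmorphM (real_complex R)). Qed.

Lemma toCV (R : realType) (x : R) : toC x^-1 = (toC x)^-1.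
Proof. exact: (fmorphV (real_complex R)). Qed.

Lemma toC0 (R : realType) : toC (0 : R) = 0. Proof. by []. Qed.

Lemma toC1 (R : realType) : toC (1 : R) = 1. Proof. by []. Qed.

Lemma toC_pos (R : realType) (e : Cfield R) : 0 < e ->
  exists2 r : R, 0 < r & e = toC r.
Proof.
move=> e0; have /complex_realP[r er] := gtr0_real e0.
by exists r => //; rewrite -toC_lt -[toC r]er.
Qed.

Lemma normE (R : realType) (V : normedModType (Cfield R)) (v : V) :
  `|v| = toC (modulus v).
Proof.
have /complex_realP[k kE] : `|v| \is Num.real by exact: normr_real.
by rewrite /modulus kE.
Qed.

Section Modulus.
Variables (R : realType) (V : normedModType (Cfield R)).
Implicit Types (v w : V) (a : Cfield R).

Lemma modulus_ge0 v : 0 <= modulus v.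
Proof. by rewrite -toC_le -normE normr_ge0. Qed.

Lemma modulus0 : modulus (0 : V) = 0.
Proof. by rewrite /modulus normr0. Qed.

Lemma modulusN v : modulus (- v) = modulus v.
Proof. by rewrite /modulus normrN. Qed.

Lemma modulus_gt0 v : (0 < modulus v) = (v != 0).
Proof. by rewrite -toC_lt -normE normr_gt0. Qed.

Lemma modulus_eq0 v : (modulus v == 0) = (v == 0).
Proof. by rewrite -[LHS]negbK -[RHS]negbK -modulus_gt0 lt0r modulus_ge0 andbT. Qed.

Lemma modulusD v w : modulus (v + w) <= modulus v + modulus w.
Proof. by rewrite -toC_le toCD -!normE; exact: ler_normD. Qed.

Lemma modulusB v w : modulus (v - w) <= modulus v + modulus w.
Proof. by rewrite -(modulusN w); exact: modulusD. Qed.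

Lemma modulus_distC v w : modulus (v - w) = modulus (w - v).
Proof. by rewrite -modulusN opprB. Qed.

Lemma modulusZ a v : modulus (a *: v) = modulus a * modulus v.
Proof.
by apply: (@complexI R); rewrite -[LHS]normE -[RHS]/(toC _) toCM -!normE normrZ.
Qed.

Lemma nbhs_modulusP v (A : set V) :
  nbhs v A <-> exists2 r : R, 0 < r & forall w, modulus (w - v) < r -> A w.
Proof.
split.
  move/nbhs_ballP => [e /toC_pos[r r0 ->] rA]; exists r => // w wr; apply: rA.
  by rewrite -ball_normE /= distrC normE toC_lt.
move=> [r r0 rA]; apply/nbhs_ballP; exists (toC r); rewrite /= ?toC_lt// => w.
by rewrite -ball_normE /= distrC normE toC_lt; exact: rA.
Qed.

End Modulus.

Section ComplexModulus.
Variable R : realType.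
Implicit Types z w : Cfield R.

Lemma modulusM z w : modulus (z * w) = modulus z * modulus w.
Proof.
by apply: (@complexI R); rewrite -[LHS]normE -[RHS]/(toC _) toCM -!normE normrM.
Qed.

Lemma modulus1 : modulus (1 : Cfield R) = 1.
Proof. by rewrite /modulus normr1. Qed.

Lemma modulusV z : modulus z^-1 = (modulus z)^-1.
Proof.
by apply: (@complexI R); rewrite -[LHS]normE -[RHS]/(toC _) toCV -!normE normfV.
Qed.

Lemma modulusX z n : modulus (z ^+ n) = modulus z ^+ n.
Proof.
by elim: n => [|n IH]; rewrite ?expr0 ?modulus1// !exprS modulusM IH.
Qed.

Lemma modulus_toC (x : R) : modulus (toC x) = `|x|.
Proof. by rewrite /modulus normc_def /= expr0n addr0 sqrtr_sqr. Qed.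

Lemma Re_le_modulus z : `|complex.Re z| <= modulus z.
Proof. by rewrite -toC_le -normE; exact: normc_ge_Re. Qed.

Lemma modulus_le_ReIm z : modulus z <= `|complex.Re z| + `|complex.Im z|.
Proof.
rewrite /modulus normc_def /= -[leRHS]ger0_norm ?addr_ge0// -sqrtr_sqr.
rewrite ler_wsqrtr// sqrrD !real_normK ?num_real// addrAC lerDl mulrn_wge0//.
Qed.

Lemma Im_le_modulus z : `|complex.Im z| <= modulus z.
Proof.
rewrite /modulus normc_def /= -sqrtr_sqr ler_wsqrtr// lerDr.
exact: sqr_ge0.
Qed.

Lemma ReB z w : complex.Re (z - w) = complex.Re z - complex.Re w.
Proof. by case: z w => [? ?] [? ?]. Qed.

Lemma ImB z w : complex.Im (z - w) = complex.Im z - complex.Im w.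
Proof. by case: z w => [? ?] [? ?]. Qed.

Lemma exists_rotation z : exists2 c : Cfield R, modulus c = 1 &
  complex.Re (c * z) = modulus z.
Proof.
have [->|z0] := eqVneq z 0.
  by exists 1; rewrite ?modulus1// mulr0 modulus0.
exists (`|z| / z).
  by rewrite modulusM modulusV normE modulus_toC ger0_norm ?modulus_ge0//
     divff// modulus_eq0.
by rewrite divfK.
Qed.

End ComplexModulus.

Lemma derivable_modulusP (R : realType) (f : Cfield R -> Cfield R) (p : Cfield R) :
  derivable f p 1 -> exists D : Cfield R, forall e, 0 < e ->
    exists2 δ : R, 0 < δ & forall z, modulus (z - p) < δ ->
      modulus (f z - f p - D * (z - p)) <= e * modulus (z - p).
Proof.
move=> fp; exists ('D_1 f p) => e e0.
have /eqaddoP/(_ (toC e)) := derivable_nbhs fp.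
rewrite toC_lt => /(_ e0)/nbhs_modulusP[δ δ0 H]; exists δ => // z zδ.
have := H (z - p); rewrite subr0 => /(_ zδ).
rewrite [X in `|X|](_ : _ = f z - f p - 'D_1 f p * (z - p)).
  by rewrite !normE -toCM toC_le.
rewrite !fctE /= [_%:A]mulr1 subrK opprD addrA; congr (_ - _).
by rewrite mulrC.
Qed.

Lemma nbhs_CfieldP (R : realType) (z : Cfield R) (A : set (Cfield R)) :
  nbhs z A <-> exists2 r : R, 0 < r & forall w, modulus (w - z) < r -> A w.
Proof. exact: nbhs_modulusP. Qed.

(** * Primitives and polar coordinates *)

Section Plane.
Variable R : realType.
Notation C := (Cfield R).

Lemma continuous_complexRe : continuous (fun z : C => complex.Re z : R).
Proof.
move=> z A /nbhs_ballP[e /= e0 eA]; apply: (nbhs_CfieldP _ _).2; exists e => // w we.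
apply: eA; rewrite -ball_normE /= -ReB.
by apply: le_lt_trans (Re_le_modulus _) _; rewrite modulus_distC.
Qed.

Lemma continuous_complexIm : continuous (fun z : C => complex.Im z : R).
Proof.
move=> z A /nbhs_ballP[e /= e0 eA]; apply: (nbhs_CfieldP _ _).2; exists e => // w we.
apply: eA; rewrite -ball_normE /= -ImB.
by apply: le_lt_trans (Im_le_modulus _) _; rewrite modulus_distC.
Qed.

Lemma continuous_Complex (T : topologicalType) (f g : T -> R) (t : T) :
  {for t, continuous f} -> {for t, continuous g} ->
  {for t, continuous (fun t => Complex (f t) (g t) : C)}.
Proof.
move=> fc gc A /nbhs_modulusP[r r0 rA]; rewrite /nbhs/=.
have r20 : 0 < r / 2 by rewrite divr_gt0.
have /cvgrPdist_lt/(_ _ r20) fr := fc; have /cvgrPdist_lt/(_ _ r20) gr := gc.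
near=> u; apply: rA; apply: le_lt_trans (modulus_le_ReIm _) _.
rewrite [r]splitr ltrD// ?ReB ?ImB/= distrC.
  by near: u.
by near: u.
Unshelve. all: by end_near. Qed.

Lemma exists_primitive (f : R -> R) (a b : R) : continuous f ->
  exists G : R -> R, forall x, a <= x <= b -> is_derive x 1 G (f x).
Proof.
move=> fc; pose G x := (\int[@lebesgue_measure R]_(t in `[a - 1, x]) f t)%R.
exists G => x /andP[ax xb].
have [] := @continuous_FTC1_closed R f (a - 1) x (b + 1).
- by rewrite (le_lt_trans xb)// ltrDl.
- apply: continuous_compact_integrable; first exact: segment_compact.
  exact: continuous_subspaceT.
- by rewrite (lt_le_trans _ ax)// ltrBlDr ltrDl.
- exact: fc.
move=> dG dGE; apply: DeriveDef; first exact: dG.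
by rewrite -derive1E; exact: dGE.
Qed.

(** Stands in for the bound of an integral by the supremum of the integrand,
    the integral being the increment of a primitive. *)
Lemma increment_le (G g : R -> R) (a b m : R) : a <= b ->
  (forall x, a <= x <= b -> is_derive x 1 G (g x)) ->
  (forall x, a <= x <= b -> `|g x| <= m) ->
  `|G b - G a| <= m * (b - a).
Proof.
move=> ab dG gm.
have dG' x : x \in `]a, b[%R -> is_derive x 1 G (g x).
  by rewrite in_itv/= => /andP[? ?]; apply: dG; rewrite !ltW.
have Gc : {within `[a, b], continuous G}.
  apply: derivable_within_continuous => x; rewrite in_itv/= => xab.
  exact: (@ex_derive _ _ _ _ _ _ _ (dG x xab)).
have [c] := MVT_segment ab dG' Gc.
rewrite in_itv/= => cab ->; rewrite normrM [`|b - a|]ger0_norm ?subr_ge0//.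
by rewrite ler_wpM2r ?subr_ge0// gm.
Qed.

Definition polar (r t : R) : C := Complex (r * cos t) (r * sin t).

Lemma modulus_polar r t : 0 <= r -> modulus (polar r t) = r.
Proof.
move=> r0; rewrite /modulus normc_def /= !exprMn -mulrDr cos2Dsin2 mulr1.
by rewrite sqrtr_sqr ger0_norm.
Qed.

Lemma continuous_polarl t : continuous (polar^~ t).
Proof.
move=> r.
apply: (@continuous_Complex R (fun r => r * cos t) (fun r => r * sin t) r);
  apply: (@continuousM _ _ id (cst _)) => //; exact: cst_continuous.
Qed.

Lemma continuous_polarr r : continuous (polar r).
Proof.
move=> t; apply: (@continuous_Complex _ (fun t => r * cos t) (fun t => r * sin t));
  apply: (@continuousM _ _ (cst r)); try exact: cst_continuous.
  exact: continuous_cos.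
exact: continuous_sin.
Qed.

Lemma cos_dist_le (t u : R) : `|cos t - cos u| <= `|t - u|.
Proof.
wlog ut : t u / u <= t => [H|].
  have [/H//|/ltW/H] := leP u t.
  by rewrite distrC [leRHS]distrC.
rewrite [leRHS]ger0_norm ?subr_ge0// -[leRHS]mul1r.
apply: (@increment_le _ (fun x => - sin x)) => // x _; rewrite normrN.
by rewrite ler_norml sin_geN1 sin_le1.
Qed.

Lemma sin_dist_le (t u : R) : `|sin t - sin u| <= `|t - u|.
Proof.
wlog ut : t u / u <= t => [H|].
  have [/H//|/ltW/H] := leP u t.
  by rewrite distrC [leRHS]distrC.
rewrite [leRHS]ger0_norm ?subr_ge0// -[leRHS]mul1r.
apply: (@increment_le _ cos) => // x _.
by rewrite ler_norml cos_geN1 cos_le1.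
Qed.

Lemma polar_dist (r s t u : R) : 0 <= r ->
  modulus (polar r t - polar s u) <= 2 * (`|r - s| + r * `|t - u|).
Proof.
move=> r0; apply: le_trans (modulus_le_ReIm _) _; rewrite ReB ImB /=.
have -> : r * cos t - s * cos u = r * (cos t - cos u) + (r - s) * cos u by ring.
have -> : r * sin t - s * sin u = r * (sin t - sin u) + (r - s) * sin u by ring.
rewrite mulr_natl mulr2n; apply: lerD; apply: le_trans (ler_normD _ _) _;
  rewrite !normrM (ger0_norm r0) addrC lerD//.
- by rewrite -[leRHS]mulr1 ler_wpM2l// ler_norml cos_geN1 cos_le1.
- by rewrite ler_wpM2l// cos_dist_le.
- by rewrite -[leRHS]mulr1 ler_wpM2l// ler_norml sin_geN1 sin_le1.
- by rewrite ler_wpM2l// sin_dist_le.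
Qed.

End Plane.

(** * Goursat's argument on polar rectangles *)

Lemma ReM (R : realType) (z w : Cfield R) :
  complex.Re (z * w) =
  complex.Re z * complex.Re w - complex.Im z * complex.Im w.
Proof. by case: z w => [? ?] [? ?]. Qed.

Lemma ImM (R : realType) (z w : Cfield R) :
  complex.Im (z * w) =
  complex.Re z * complex.Im w + complex.Im z * complex.Re w.
Proof. by case: z w => [? ?] [? ?]. Qed.

(** The integral of [Re (φ(z) dz / (i z))] along the boundary of a rectangle in
    polar coordinates is an additive function of the rectangle.  It is exactly
    0 when [φ] is affine, hence [o(diameter ^ 2)] at every point where [φ] is
    differentiable, and so it vanishes.  On the full annulus the two radial
    sides cancel, so the integrals of [Re φ] over the two circles are equal; a
    common value then exists by the mean value theorem. *)
Lemma Re_common_value_on_circles (R : realType) (φ : Cfield R -> Cfield R)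
    (ρ r : R) :
  0 < ρ -> ρ <= r ->
  (forall z, ρ <= modulus z <= r -> derivable φ z 1) ->
  exists z w, [/\ modulus z = ρ, modulus w = r &
    complex.Re (φ z) = complex.Re (φ w)].
Proof.
move=> ρ0 ρr dφ.
have r0 : 0 < r by exact: lt_le_trans ρr.
(* Clamping the radius to [ρ, r] makes the coefficients continuous on the whole
   line, so that their primitives exist. *)
pose clamp (s : R) := Num.max ρ (Num.min r s).
have clampP s : ρ <= clamp s <= r.
  by rewrite /clamp le_max lexx ge_max ρr ge_min lexx.
have clampE s : ρ <= s <= r -> clamp s = s.
  by move=> /andP[? ?]; rewrite /clamp (min_idPr _)// (max_idPr _).
have clampc : continuous clamp.
  move=> s; apply: (@continuous_max R R (cst ρ) (Num.min r)).
    exact: cst_continuous.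
  apply: (@continuous_min R R (cst r) id) => //; exact: cst_continuous.
have clamp0 s : 0 < clamp s.
  by have /andP[h _] := clampP s; exact: lt_le_trans h.
have φc s t : {for polar (clamp s) t, continuous φ}.
  apply: differentiable_continuous; apply/derivable1_diffP; apply: dφ.
  by rewrite modulus_polar ?clampP// ltW.
pose P t s := complex.Im (φ (polar (clamp s) t)) / clamp s.
pose Q s t := complex.Re (φ (polar (clamp s) t)).
have Pc t : continuous (P t).
  move=> s; apply: (@continuousM R R (fun s => complex.Im (φ (polar (clamp s) t)))
     (fun s => (clamp s)^-1)); last first.
    by apply: continuousV; [rewrite gt_eqF|exact: clampc].
  apply: (@continuous_comp _ _ _ (fun s => φ (polar (clamp s) t)) (@complex.Im R));
    last exact: continuous_complexIm.
  apply: (@continuous_comp _ _ _ (fun s => polar (clamp s) t) φ); last exact: φc.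
  have := @continuous_comp R R (Cfield R) clamp (fun u : R => polar u t) s.
  by apply; [exact: clampc|exact: continuous_polarl].
have Qc s : continuous (Q s).
  move=> t.
  apply: (@continuous_comp _ _ _ (fun t => φ (polar (clamp s) t)) (@complex.Re R));
    last exact: continuous_complexRe.
  apply: (@continuous_comp _ _ _ (polar (clamp s)) φ); last exact: φc.
  exact: continuous_polarr.
have [A dA] : {A : R -> R -> R | forall t s, ρ <= s <= r ->
    is_derive s 1 (A t) (P t s)}.
  have h t := cid (exists_primitive ρ r (Pc t)).
  by exists (fun t => sval (h t)) => t; exact: (svalP (h t)).
pose T := 2 * pi : R.
have T0 : 0 < T by rewrite mulr_gt0// pi_gt0.
have [B dB] : {B : R -> R -> R | forall s t, 0 <= t <= T ->
    is_derive t 1 (B s) (Q s t)}.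
  have h s := cid (exists_primitive 0 T (Qc s)).
  by exists (fun s => sval (h s)) => s; exact: (svalP (h s)).
(* [P] and [Q] are the coefficients of the form along the radius and along the
   angle; [A] and [B] are their primitives. *)
pose J a b p q := (A p b - A p a) - (A q b - A q a)
  + (B b q - B b p) - (B a q - B a p).
have J0 : J ρ r 0 T = 0.
  apply: additive_small_rectangle_function_eq0 => //.
  - by move=> a b c p q; rewrite /J; ring.
  - by move=> a b p q t; rewrite /J; ring.
  - exact: ltW.
  move=> x y xr yT e e0.
  have /derivable_modulusP[D dD] : derivable φ (polar x y) 1.
    by apply: dφ; rewrite modulus_polar// ltW// (lt_le_trans ρ0)//; case/andP: xr.
  pose K := 2 * (1 + r).
  have K0 : 0 < K by rewrite mulr_gt0// addr_gt0.
  have ρV0 : 0 < ρ^-1 by rewrite invr_gt0.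
  pose ε := e / (2 * K * (ρ^-1 + 1)).
  have ε0 : 0 < ε by rewrite divr_gt0// mulr_gt0 ?mulr_gt0// addr_gt0.
  have [δ δ0 δP] := dD _ ε0; exists (δ / (2 * K)).
    by rewrite divr_gt0// mulr_gt0.
  move=> a b p q ρa axb br p0 pyq qT baδ qpδ.
  pose s := (b - a) + (q - p).
  have ab : a <= b by move: axb => /andP[ax xb]; exact: le_trans xb.
  have pq : p <= q by move: pyq => /andP[py yq]; exact: le_trans yq.
  have close (c d u v : R) : c <= u <= d -> c <= v <= d -> `|u - v| <= d - c.
    by move=> /andP[? ?] /andP[? ?]; rewrite ler_norml; apply/andP; split; lra.
  have s0 : 0 <= s by rewrite addr_ge0 ?subr_ge0.
  have sδ : K * s < δ.
    have -> : δ = K * (δ / (2 * K) + δ / (2 * K)) by field; rewrite gt_eqF.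
    by rewrite ltr_pM2l// ltrD.
  pose err z := φ z - φ (polar x y) - D * (z - polar x y).
  pose m := ε * K * s.
  have errP u t : a <= u <= b -> p <= t <= q -> modulus (err (polar u t)) <= m.
    move=> uab tpq.
    have ux := close _ _ _ _ uab axb; have ty := close _ _ _ _ tpq pyq.
    have dK : modulus (polar u t - polar x y) <= K * s.
      apply: le_trans (polar_dist _ _ _ _) _.
        by case/andP: uab => au _; rewrite (le_trans _ au)// (le_trans _ ρa)// ltW.
      rewrite /K -mulrA ler_pM2l// mulrDl mul1r.
      have ub : u <= r by case/andP: uab => _ /le_trans; apply.
      have : u * `|t - y| <= r * s.
        rewrite ler_pM//; last by rewrite (le_trans ty)// lerDr subr_ge0.
        by case/andP: uab => au _; rewrite (le_trans _ au)// (le_trans _ ρa)// ltW.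
      by move/(lerD _); apply; rewrite (le_trans ux)// lerDl subr_ge0.
    apply: le_trans (δP _ (le_lt_trans dK sδ)) _.
    by rewrite /m -mulrA ler_pM2l.
  have inr u : a <= u <= b -> ρ <= u <= r.
    by move=> /andP[au ub]; rewrite (le_trans ρa)//= (le_trans ub).
  have inT t : p <= t <= q -> 0 <= t <= T.
    by move=> /andP[pt tq]; rewrite (le_trans p0)//= (le_trans tq).
  have pin : p <= p <= q by rewrite lexx.
  have qin : p <= q <= q by rewrite lexx andbT.
  have ain : a <= a <= b by rewrite lexx.
  have bin : a <= b <= b by rewrite lexx andbT.
  pose k t := complex.Im (D * polar 1 t).
  pose k' t := complex.Re (D * polar 1 t).
  have polarE u t : polar u t = toC u * polar 1 t.
    by rewrite /polar /toC; apply/eqP; rewrite eq_complex /= !mul1r !mul0r;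
       rewrite subr0 addr0 !eqxx.
  have Reu u t : complex.Re (D * polar u t) = u * k' t.
    by rewrite polarE mulrCA ReM /= mul0r subr0.
  have Imu u t : complex.Im (D * polar u t) = u * k t.
    by rewrite polarE mulrCA ImM /= mul0r addr0.
  have dk (t : R) : is_derive t 1 k (k' t).
    have -> : k = complex.Re D *: sin + complex.Im D *: cos.
      by apply/funext => v; rewrite /k ImM /= !mul1r.
    have H := is_deriveD (is_deriveZ (complex.Re D) (is_derive_sin t))
      (is_deriveZ (complex.Im D) (is_derive_cos t)).
    by apply: (is_derive_eq H); rewrite /k' ReM /= !mul1r /GRing.scale /= mulrN.
  (* The form of the affine approximation of [φ] integrates to 0: its constant
     term has the same radial integral on both sides, and its linear part is
     the differential of [Im (D z)].  What remains is the integral of the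
     error term. *)
  pose GA u := A p u - A q u - (k p - k q) * u.
  have GAle : `|GA b - GA a| <= (2 * m / ρ) * (b - a).
    apply: (@increment_le _ _ (fun u => P p u - P q u - (k p - k q))) => //.
      move=> u uab; have u_ := inr _ uab.
      have H := is_deriveB (is_deriveB (dA p u u_) (dA q u u_))
        (is_deriveZ (k p - k q) (is_derive_id u 1)).
      by apply: (is_derive_eq H); rewrite /GRing.scale /= mulr1.
    move=> u uab; have u_ := inr _ uab.
    have u0 : 0 < u by case/andP: u_ => /(lt_le_trans ρ0).
    have -> : P p u - P q u - (k p - k q) =
        complex.Im (err (polar u p) - err (polar u q)) / u.
      rewrite /P !clampE// /err !ImB !mulrBr !ImB !Imu.
      by field; rewrite gt_eqF.
    rewrite normrM normfV (gtr0_norm u0) ler_pM ?invr_ge0 ?(ltW u0)//; last first.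
      by rewrite lef_pV2 ?posrE//; case/andP: u_.
    apply: le_trans (Im_le_modulus _) _; apply: le_trans (modulusB _ _) _.
    by rewrite mulr_natl mulr2n lerD// errP.
  pose GB t := B b t - B a t - (b - a) * k t.
  have GBle : `|GB q - GB p| <= (2 * m) * (q - p).
    apply: (@increment_le _ _ (fun t => Q b t - Q a t - (b - a) * k' t)) => //.
      move=> t tpq; have t_ := inT _ tpq.
      have H := is_deriveB (is_deriveB (dB b t t_) (dB a t t_))
        (is_deriveZ (b - a) (dk t)).
      exact: (is_derive_eq H).
    move=> t tpq.
    have -> : Q b t - Q a t - (b - a) * k' t =
        complex.Re (err (polar b t) - err (polar a t)).
      rewrite /Q !clampE ?inr// /err !ReB !mulrBr !ReB !Reu.
      by ring.
    apply: le_trans (Re_le_modulus _) _; apply: le_trans (modulusB _ _) _.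
    by rewrite mulr_natl mulr2n lerD// errP.
  have -> : J a b p q = (GA b - GA a) + (GB q - GB p).
    by rewrite /J /GA /GB; ring.
  apply: le_trans (ler_normD _ _) _; apply: le_trans (lerD GAle GBle) _.
  have m0 : 0 <= m by rewrite /m mulr_ge0 ?(mulr_ge0 (ltW ε0) (ltW K0)).
  apply: (@le_trans _ _ (2 * m * (ρ^-1 + 1) * s)).
    have -> : 2 * m * (ρ^-1 + 1) * s = 2 * m / ρ * s + 2 * m * s by ring.
    have m2 : 0 <= 2 * m by rewrite mulr_ge0.
    apply: lerD; apply: ler_wpM2l => //.
    - by rewrite mulr_ge0// ltW.
    - by rewrite lerDl subr_ge0.
    - by rewrite lerDr subr_ge0.
  rewrite /m /ε le_eqVlt; apply/orP; left; apply/eqP.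
  have cancel (g K' s' : R) : g != 0 -> K' != 0 ->
      2 * (e / (2 * K' * g) * K' * s') * g * s' = e * s' ^+ 2.
    by move=> g_neq0 K_neq0; field; rewrite g_neq0 K_neq0.
  by rewrite cancel// gt_eqF// addr_gt0.
have A0T : A 0 r - A 0 ρ - (A T r - A T ρ) = 0.
  apply/eqP; rewrite -normr_le0 -[leRHS](mul0r (r - ρ)).
  have -> : A 0 r - A 0 ρ - (A T r - A T ρ) = (A 0 r - A T r) - (A 0 ρ - A T ρ).
    by ring.
  apply: (@increment_le _ (A 0 - A T) (P 0 - P T)) => // s sr.
    by have := dA 0 s sr; have := dA T s sr => *; exact: is_deriveB.
  have -> : P 0 = P T.
    apply/funext => u; rewrite /P /polar /T mulr_natl.
    by rewrite cos2pi sin2pi cos0 sin0.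
  by rewrite subrr /= normr0.
have meanB s : exists2 t, True & B s T - B s 0 = Q s t * T.
  have dB' t : t \in `]0, T[ -> is_derive t 1 (B s) (Q s t).
    by rewrite in_itv/= => /andP[? ?]; apply: dB; rewrite !ltW.
  have Bc : {within `[0, T], continuous (B s)}.
    apply: derivable_within_continuous => x; rewrite in_itv/= => xab.
    exact: (@ex_derive _ _ _ _ _ _ _ (dB s x xab)).
  by have [c _] := MVT_segment (ltW T0) dB' Bc; rewrite subr0 => ->; exists c.
have [t _ tE] := meanB ρ; have [u _ uE] := meanB r.
exists (polar ρ t), (polar r u); rewrite !modulus_polar ?ltW//; split => //.
have := J0; rewrite /J A0T add0r uE tE -mulrBl => /eqP.
rewrite mulf_eq0 (gt_eqF T0) orbF subr_eq0 => /eqP.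
by rewrite /Q !clampE ?lexx ?ρr.
Qed.

(** * Maximum principle and dominated sums *)

(** After rotating so that [φ 0] is real and nonnegative, [Re φ] on a tiny
    circle is close to [modulus (φ 0)] and attains one of its values again on
    the circle of radius [r].  Differentiability at the centre itself is
    replaced by continuity, because the lemma is used for difference quotients
    at 0. *)
Lemma modulus_center_le (R : realType) (φ : Cfield R -> Cfield R) (r M : R) :
  0 < r -> {for 0, continuous φ} ->
  (forall z, 0 < modulus z <= r -> derivable φ z 1) ->
  (forall z, modulus z = r -> modulus (φ z) <= M) ->
  modulus (φ 0) <= M.
Proof.
move=> r0 φ0 dφ φM; apply/ler_addgt0Pr => e e0.
have [c c1 cE] := exists_rotation (φ 0).
have : nbhs (φ 0) [set w | modulus (w - φ 0) < e].
  by apply/nbhs_CfieldP; exists e.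
move/φ0 => /nbhs_CfieldP[δ δ0 δP].
have ρ0 : 0 < Num.min (δ / 2) r by rewrite lt_min r0 divr_gt0.
have ρr : Num.min (δ / 2) r <= r by rewrite ge_min lexx orbT.
have dcφ z : Num.min (δ / 2) r <= modulus z <= r -> derivable (c *: φ) z 1.
  move=> /andP[z1 z2]; apply: derivableZ; apply: dφ.
  by rewrite z2 (lt_le_trans ρ0).
have [z [w [zρ wr zw]]] := Re_common_value_on_circles ρ0 ρr dcφ.
have zδ : modulus (φ z - φ 0) < e.
  apply: δP; rewrite subr0 zρ (@le_lt_trans _ _ (δ / 2)) ?ge_min ?lexx//.
  by rewrite ltr_pdivrMr// ltr_pMr// ltr1n.
have : complex.Re (c * φ w) <= M.
  apply: le_trans (ler_norm _) _; apply: le_trans (Re_le_modulus _) _.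
  by rewrite modulusM c1 mul1r φM.
have : complex.Re (c * (φ 0 - φ z)) <= e.
  apply: le_trans (ler_norm _) _; apply: le_trans (Re_le_modulus _) _.
  by rewrite modulusM c1 mul1r modulus_distC ltW.
rewrite mulrBr ReB cE; move: zw.
rewrite -[(c *: φ) z]/(c * φ z) -[(c *: φ) w]/(c * φ w).
by move=> ->; lra.
Qed.

Section DominatedSums.
Variable R : realType.
Notation C := (Cfield R).
Implicit Types (u v : nat -> C) (s : C).

Definition dominated u (B : R) := forall n, modulus (u n) <= B * 2^-1 ^+ n.

Definition sums_to u s := exists B : R,
  forall N, modulus (\sum_(i < N) u i - s) <= B * 2^-1 ^+ N.

Definition dsum u : C := xget 0 [set s | sums_to u s].

(** The partial sums, each widened by the bound [2 B / 2 ^ N] of its tail, form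
    nested intervals. *)
Lemma exists_real_sum (x : nat -> R) (B : R) :
  (forall n, `|x n| <= B * 2^-1 ^+ n) ->
  exists s : R, forall N, `|\sum_(i < N) x i - s| <= 2 * B * 2^-1 ^+ N.
Proof.
move=> xB; pose p N : R := B * 2^-1 ^+ N.
have p0 N : 0 <= p N by apply: le_trans (xB N).
have pS N : p N = p N.+1 + p N.+1 by rewrite /p exprS; lra.
have xp N : - p N <= x N <= p N by rewrite -ler_norml.
have [||| s sP] := @nested_intervals_inhabited R
    (fun N => \sum_(i < N) x i - 2 * p N) (fun N => 4 * p N).
- by move=> N; rewrite mulr_ge0.
- by move=> N; rewrite big_ord_recr /=; have := xp N; have := pS N; lra.
- by move=> N; rewrite big_ord_recr /=; have := xp N; have := pS N; lra.
exists s => N; rewrite -mulrA -/(p N) ler_norml.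
by have := sP N; lra.
Qed.

Lemma sum_ReIm (N : nat) u : \sum_(i < N) u i =
  Complex (\sum_(i < N) complex.Re (u i)) (\sum_(i < N) complex.Im (u i)).
Proof.
elim: N => [|N IH]; first by rewrite !big_ord0.
by rewrite !big_ord_recr /= IH; case: (u N).
Qed.

Lemma sums_to_unique u s s' : sums_to u s -> sums_to u s' -> s = s'.
Proof.
move=> [B BP] [B' BP']; apply/eqP; rewrite -subr_eq0 -modulus_eq0.
apply/eqP/le_anti; rewrite modulus_ge0 andbT.
apply/ler_addgt0Pr => e e0; rewrite add0r.
have [n /(_ n (leqnn n)) lt_e] := exists_half_pow_lt (B + B') e0.
have -> : s - s' = (\sum_(i < n) u i - s') - (\sum_(i < n) u i - s) by ring.
apply: le_trans (modulusB _ _) _; apply: le_trans (lerD (BP' n) (BP n)) _.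
by rewrite -mulrDl addrC ltW.
Qed.

Lemma sums_to_dsum u s : sums_to u s -> dsum u = s.
Proof.
rewrite /dsum => us; case: xgetP => [t _ ut|/(_ s)//].
exact: sums_to_unique us.
Qed.

Lemma dominated_dsum u (B : R) : dominated u B ->
  forall N, modulus (\sum_(i < N) u i - dsum u) <= 4 * B * 2^-1 ^+ N.
Proof.
move=> uB.
have [x xP] := exists_real_sum (fun n => le_trans (Re_le_modulus _) (uB n)).
have [y yP] := exists_real_sum (fun n => le_trans (Im_le_modulus _) (uB n)).
have sP N : modulus (\sum_(i < N) u i - Complex x y) <= 4 * B * 2^-1 ^+ N.
  apply: le_trans (modulus_le_ReIm _) _; rewrite ReB ImB sum_ReIm /=.
  have := xP N; have := yP N; move: (_ ^+ N) => t; lra.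
rewrite (@sums_to_dsum u (Complex x y)) //.
by exists (4 * B).
Qed.

Lemma modulus_dsum u (B : R) : dominated u B -> modulus (dsum u) <= 4 * B.
Proof.
by move=> /dominated_dsum/(_ 0%N); rewrite big_ord0 sub0r modulusN mulr1.
Qed.

Lemma dominatedM u v (B b : R) : dominated u B -> (forall n, modulus (v n) <= b) ->
  dominated (fun n => u n * v n) (B * b).
Proof.
by move=> uB vb n; rewrite modulusM mulrAC ler_pM ?modulus_ge0.
Qed.

Lemma dominated_ge0 u (B : R) : dominated u B -> 0 <= B.
Proof. by move=> /(_ 0%N); rewrite mulr1; apply: le_trans (modulus_ge0 _). Qed.

Lemma dsum_linear u v (a : C) (B B' : R) : dominated u B -> dominated v B' ->
  dsum (fun n => u n + a * v n) = dsum u + a * dsum v.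
Proof.
move=> uB vB; apply: sums_to_dsum.
exists (4 * B + modulus a * (4 * B')) => N.
have -> : \sum_(i < N) (u i + a * v i) - (dsum u + a * dsum v) =
    (\sum_(i < N) u i - dsum u) + a * (\sum_(i < N) v i - dsum v).
  by rewrite big_split /= -mulr_sumr; ring.
apply: le_trans (modulusD _ _) _; rewrite mulrDl lerD//.
  exact: dominated_dsum.
rewrite modulusM -mulrA ler_wpM2l ?modulus_ge0//.
exact: dominated_dsum.
Qed.

Lemma dsumM v (a : C) (B : R) : dominated v B ->
  dsum (fun n => a * v n) = a * dsum v.
Proof.
move=> vB; have z : dominated (fun=> 0) 0 by move=> n; rewrite modulus0 mul0r.
have /= := dsum_linear a z vB.
have -> : dsum (fun=> 0) = 0.
  apply: sums_to_dsum; exists 0 => N; rewrite big1// subrr modulus0.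
  by rewrite mul0r.
by rewrite add0r => <-; congr dsum; apply/funext => n; rewrite add0r.
Qed.

End DominatedSums.

(** * Taylor coefficients of sums of geometric series *)

Section Taylor.
Variable R : realType.
Notation C := (Cfield R).

Lemma inverse_one_sub_le (w : C) : modulus w <= 2^-1 ->
  1 - w != 0 /\ modulus (1 - w)^-1 <= 2.
Proof.
move=> w2; have h : 2^-1 <= modulus (1 - w).
  have := modulusD (1 - w) w; rewrite subrK modulus1; lra.
have p : 0 < modulus (1 - w) by apply: lt_le_trans h; rewrite invr_gt0.
split; first by rewrite -modulus_gt0.
by rewrite modulusV -[leRHS]invrK lef_pV2 ?posrE ?invr_gt0.
Qed.

Lemma dominated_geometric (d b : nat -> C) (D β : R) (z : C) :
  dominated d D -> (forall n, modulus (b n) <= β) -> modulus z * β <= 2^-1 ->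
  dominated (fun n => d n / (1 - z * b n)) (D * 2).
Proof.
move=> dD bβ zβ; apply: dominatedM => // n.
apply: (inverse_one_sub_le _).2; rewrite modulusM.
by apply: le_trans zβ; rewrite ler_wpM2l ?modulus_ge0.
Qed.

(** Termwise [1 / (1 - w) = 1 + w / (1 - w)] with [w = z b_n]: the difference
    quotient at 0 of a sum of geometric series is again such a sum, with [d]
    replaced by [d b]. *)
Lemma dsum_geometric_shift (d b : nat -> C) (D β : R) (z : C) :
  dominated d D -> (forall n, modulus (b n) <= β) -> modulus z * β <= 2^-1 ->
  dsum (fun n => d n / (1 - z * b n)) =
  dsum d + z * dsum (fun n => d n * b n / (1 - z * b n)).
Proof.
move=> dD bβ zβ.
have dbD : dominated (fun n => d n * b n) (D * β) by exact: dominatedM.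
rewrite -(dsum_linear z dD (dominated_geometric dbD bβ zβ)).
congr dsum; apply/funext => n.
have [|nz _] := @inverse_one_sub_le (z * b n); last by field.
by rewrite modulusM (le_trans _ zβ)// ler_wpM2l ?modulus_ge0.
Qed.

(** Near 0 the sum of geometric series is Lipschitz, so [h] is continuous at 0
    and its value there is bounded by the maximum over a circle. *)
Lemma constant_coefficient_le (h : C -> C) (d b : nat -> C) (D β M : R) :
  dominated d D -> (forall n, modulus (b n) <= β) ->
  (forall z, 0 < modulus z <= 4 -> derivable h z 1) ->
  (forall z, modulus z = 4 -> modulus (h z) <= M) ->
  (forall z, modulus z * β <= 2^-1 -> h z = dsum (fun n => d n / (1 - z * b n))) ->
  modulus (dsum d) <= M.
Proof.
move=> dD bβ dh hM hE.
have β0 : 0 <= β by apply: le_trans (bβ 0%N); exact: modulus_ge0.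
have D0 := dominated_ge0 dD.
have h0 : h 0 = dsum d.
  rewrite hE; last by rewrite modulus0 mul0r invr_ge0.
  by congr dsum; apply/funext => n; rewrite mul0r subr0 divr1.
rewrite -h0; apply: (@modulus_center_le _ _ 4 _ _ _ dh hM) => //.
move=> A /nbhs_CfieldP[e e0 eA]; apply: (nbhs_CfieldP _ _).2.
pose K := 4 * (D * β * 2) + 1.
have K0 : 0 < K by rewrite ltr_wpDl// !mulr_ge0.
have β20 : 0 < 2 * β + 1 by rewrite ltr_wpDl// mulr_ge0.
exists (Num.min (e / K) (2 * β + 1)^-1).
  by rewrite lt_min divr_gt0//= invr_gt0.
move=> z; rewrite subr0 lt_min => /andP[ze zβ].
have zβ' : modulus z * β <= 2^-1.
  have : modulus z * (2 * β + 1) < 1 by rewrite -ltr_pdivlMr// div1r.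
  rewrite mulrDr mulr1 mulrCA; have := modulus_ge0 z; lra.
apply: eA; rewrite h0 hE// (dsum_geometric_shift dD bβ zβ') addrC addKr.
have dbD : dominated (fun n => d n * b n) (D * β) by exact: dominatedM.
rewrite modulusM.
have S := modulus_dsum (dominated_geometric dbD bβ zβ').
apply: le_lt_trans (ler_wpM2l (modulus_ge0 z) S) _.
have : modulus z * K < e by rewrite -ltr_pdivlMr.
rewrite /K mulrDr mulr1; have := modulus_ge0 z; lra.
Qed.

(** Each step replaces [h] by [(h - h 0) / z], which has the same shape with
    coefficients [d b].  On the circle of radius 4 the numerator is at most
    [2 M], whence the new bound [M / 2]. *)
Lemma taylor_coefficient_le (m : nat) :
  forall (h : C -> C) (d b : nat -> C) (D β M : R),
  dominated d D -> (forall n, modulus (b n) <= β) ->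
  (forall z, 0 < modulus z <= 4 -> derivable h z 1) ->
  (forall z, modulus z = 4 -> modulus (h z) <= M) ->
  (forall z, modulus z * β <= 2^-1 -> h z = dsum (fun n => d n / (1 - z * b n))) ->
  modulus (dsum (fun n => d n * b n ^+ m)) <= M * 2^-1 ^+ m.
Proof.
elim: m => [|m IH] h d b D β M dD bβ dh hM hE.
  rewrite mulr1; have -> : (fun n => d n * b n ^+ 0) = d.
    by apply/funext => n; rewrite expr0 mulr1.
  exact: (constant_coefficient_le dD bβ dh hM hE).
pose α := dsum d.
have αM := constant_coefficient_le dD bβ dh hM hE.
pose h1 z := if z == 0 then dsum (fun n => d n * b n) else (h z - α) / z.
have -> : (fun n => d n * b n ^+ m.+1) = (fun n => d n * b n * b n ^+ m).
  by apply/funext => n; rewrite exprS mulrA.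
rewrite exprS mulrA; apply: (IH h1 _ _ (D * β) β).
- exact: dominatedM.
- by [].
- move=> z z4; have z0 : z != 0 by rewrite -modulus_gt0; case/andP: z4.
  apply: (@near_eq_derivable _ _ _ (fun z => (h z - α) * z^-1)).
    apply/nbhs_CfieldP; exists (modulus z); first by rewrite modulus_gt0.
    move=> w wz; rewrite /h1; case: eqP => // w0.
    by move: wz; rewrite w0 sub0r modulusN ltxx.
  apply: derivableM; last exact: derivableV.
  apply: derivableB; [exact: dh|exact: derivable_cst].
- move=> z z4; have z0 : z != 0 by rewrite -modulus_gt0 z4.
  rewrite /h1 (negbTE z0) modulusM modulusV z4.
  have := le_trans (modulusB _ _) (lerD (hM _ z4) αM).
  lra.
- move=> z zβ; rewrite /h1; case: eqP => [->|/eqP z0].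
    by congr dsum; apply/funext => n; rewrite mul0r subr0 divr1.
  by rewrite hE// (dsum_geometric_shift dD bβ zβ) addrC addKr mulrC mulKf.
Qed.
End Taylor.

(** * Generic subsets of the natural numbers *)

(** Baire category theorem for Cantor space: each [P j] contains a dense open
    set, expressed by the extension of finite prefixes [(l, s)]. *)
Lemma exists_bits_forcing (P : nat -> (nat -> bool) -> Prop) :
  (forall j l s, exists l' s', [/\ (l < l')%N, (forall n, (n < l)%N -> s' n = s n) &
     forall S, (forall n, (n < l')%N -> S n = s' n) -> P j S]) ->
  exists S, forall j, P j S.
Proof.
move=> step.
pose Q j (x y : nat * (nat -> bool)) :=
  [/\ (x.1 < y.1)%N, (forall n, (n < x.1)%N -> y.2 n = x.2 n) &
     forall S, (forall n, (n < y.1)%N -> S n = y.2 n) -> P j S].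
have [|j [l s] _|c [_ cQ]] := @recursive_choice _ (fun _ _ => True) Q (0%N, xpred0).
- by [].
- by have [l' [s' [? ? ?]]] := step j l s; exists (l', s').
have grow j : (j <= (c j).1)%N.
  by elim: j => // j IH; have [_ [lt _ _]] := cQ j; exact: leq_ltn_trans lt.
have stable j k n : (n < (c j).1)%N -> (c (j + k)%N).2 n = (c j).2 n /\
    (n < (c (j + k)%N).1)%N.
  move=> nj; elim: k => [|k [IH1 IH2]]; first by rewrite addn0.
  have [_ [lt eq _]] := cQ (j + k)%N.
  by rewrite addnS eq// (ltn_trans _ lt).
exists (fun n => (c n.+1).2 n) => j.
have [_ [_ _]] := cQ j; apply=> n nj.
have [le|lt] := leqP n.+1 j.+1.
  by have [<-] := stable n.+1 (j.+1 - n.+1)%N n (grow n.+1); rewrite subnKC.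
by have [<-] := stable j.+1 (n.+1 - j.+1)%N n nj; rewrite subnKC// ltnW.
Qed.

(** Condensation of singularities.  For fixed [k] the quantities
    [sum_n S_n t k m n] cannot be bounded in [m] on a whole cylinder, since
    flipping a bit [n] beyond the prefix changes them by the unbounded
    [t k m n]; so one of the two values of that bit, followed by any tail that
    is too small to matter, exceeds a prescribed bound. *)
Lemma exists_bits_unbounded (R : realType) (I : nat -> Prop)
    (t : nat -> nat -> nat -> Cfield R) :
  (forall k m, I k -> exists B : R, dominated (t k m) B) ->
  (forall k, I k -> forall N, exists2 n, (N <= n)%N &
     forall x : R, exists m, x < modulus (t k m n)) ->
  exists S : nat -> bool, forall k, I k -> forall x : R, exists m,
    x < modulus (dsum (fun n => (S n)%:R * t k m n)).
Proof.
move=> tB tn.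
have [S SP] : exists S : nat -> bool, forall j,
    if @unpickle (nat * nat)%type j is Some (k, i) then
      I k -> exists m, i%:R < modulus (dsum (fun n => (S n)%:R * t k m n))
    else True.
  apply: exists_bits_forcing => j l s.
  case: (unpickle j) => [[k i]|]; last by exists l.+1, s.
  have [Ik|nI] := pselect (I k); last by exists l.+1, s; split.
  (* The two values differ by more than [2 (i + 1)], so one of them exceeds
     [i + 1]; the remaining 1 absorbs the tail. *)
  have [n ln nx] := tn k Ik l; have [m mP] := nx (2 * (i%:R + 1)).
  have [B BP] := tB k m Ik.
  have [N NP] := @exists_half_pow_lt R (4 * B) 1 ltr01.
  pose l' := maxn n.+1 N.
  have nl' : (n < l')%N by rewrite leq_maxl.
  have l'B : 4 * B * 2^-1 ^+ l' < 1 by rewrite NP// leq_maxr.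
  pose s0 i := (i < l)%N && s i.
  pose s1 i := (i == n) || s0 i.
  pose p (S : nat -> bool) := \sum_(i < l') (S i)%:R * t k m i.
  have p01 : p s1 - p s0 = t k m n.
    rewrite -sumrB (bigD1 (Ordinal nl')) //= big1 ?addr0.
      by rewrite /s1 /s0 eqxx /= ltnNge ln /= mul1r mul0r subr0.
    move=> q qn; rewrite /s1 -[(q == n :> nat)]/(q == Ordinal nl') (negbTE qn).
    by rewrite subrr.
  have [s' [s'l ps']] : exists s', (forall q, (q < l)%N -> s' q = s q) /\
      i%:R + 1 < modulus (p s').
    have [h|h] := ltP (i%:R + 1) (modulus (p s0)).
      by exists s0; split=> // q ql; rewrite /s0 ql.
    exists s1; split.
      move=> q ql; rewrite /s1 /s0 ql /=; case: eqP => // qn.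
      by move: ql; rewrite qn ltnNge ln.
    rewrite ltNge; apply/negP => h1; move: mP; rewrite -p01 ltNge => /negP; apply.
    by apply: le_trans (modulusB _ _) _; rewrite mulr_natl mulr2n lerD.
  exists l', s'; split=> // [|S Ss' _]; first exact: leq_ltn_trans nl'.
  exists m.
  have SB : dominated (fun n => (S n)%:R * t k m n) B.
    move=> q; apply: le_trans (BP q); rewrite modulusM.
    by case: (S q); rewrite ?modulus1 ?mul1r// modulus0 mul0r modulus_ge0.
  have := dominated_dsum SB l'.
  have -> : \sum_(q < l') (S q)%:R * t k m q = p s'.
    by apply: eq_bigr => q _; rewrite Ss'.
  move: (dsum _) => D pD.
  have := modulusD (p s' - D) D; rewrite subrK; lra.
exists S => k Ik x.
have [i xi] : exists i : nat, x < i%:R.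
  by exists (Num.bound `|x|); exact: le_lt_trans (ler_norm x) (archi_boundP _).
have := SP (pickle (k, i)); rewrite pickleK => /(_ Ik)[m mP].
by exists m; exact: lt_trans mP.
Qed.

(** * Complex linear forms and differentiability of sums of reciprocals *)

(** If the inequality failed, the multiple of [h] at which the affine form
    [c + L] vanishes would have modulus less than [ρ].  It gives bounds on [L]
    that depend on the form only through its value at the centre of a ball
    without zeros, hence are uniform over all the forms in a series. *)
Lemma nonvanishing_linear_le (R : realType) (V : normedModType (Cfield R))
    (L : V -> Cfield R) (c : Cfield R) (ρ : R) :
  (forall a h, L (a *: h) = a * L h) ->
  (forall h, modulus h < ρ -> c + L h != 0) ->
  forall h, modulus (L h) * ρ <= modulus c * modulus h.
Proof.
move=> LZ nz h; rewrite leNgt; apply/negP => lt.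
have Lh0 : L h != 0.
  apply/eqP => L0; move: lt; rewrite L0 modulus0 mul0r ltNge.
  by rewrite mulr_ge0 ?modulus_ge0.
have /nz/negP : modulus (- (c / L h) *: h) < ρ.
  rewrite modulusZ modulusN modulusM modulusV mulrAC.
  by rewrite ltr_pdivrMr ?modulus_gt0// [ltRHS]mulrC.
by apply; rewrite LZ mulNr divfK// subrr.
Qed.

Lemma differentiable_of_expansion (R : realType) (V : normedModType (Cfield R))
    (f df : V -> Cfield R) (x : V) (K r : R) :
  0 < r -> (forall a h k, df (a *: h + k) = a * df h + df k) ->
  (forall h, modulus (df h) <= K * modulus h) ->
  (forall h, modulus h < r ->
    modulus (f (x + h) - f x - df h) <= K * modulus h ^+ 2) ->
  differentiable f x.
Proof.
move=> r0 lin bnd exp.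
pose L : {linear V -> Cfield R} := HB.pack df
  (GRing.isLinear.Build (Cfield R) V (Cfield R) *:%R df lin).
have Kp0 : 0 < `|K| + 1 by rewrite ltr_wpDl.
have Lc : continuous L.
  move=> y A /nbhs_CfieldP[e e0 eA]; apply: (nbhs_modulusP _ _).2.
  exists (e / (`|K| + 1)); first by rewrite divr_gt0.
  move=> z zy; apply: eA; rewrite -linearB.
  apply: le_lt_trans (bnd _) _; move: zy; rewrite ltr_pdivlMr// mulrC.
  apply: le_lt_trans; rewrite ler_wpM2r ?modulus_ge0//.
  by rewrite (le_trans (ler_norm _))// lerDl.
have oE : f \o shift x = cst (f x) + L +o_ 0 id.
  apply/eqaddoP => _ /toC_pos[e e0 ->]; apply/nbhs_modulusP.
  exists (Num.min r (e / (`|K| + 1))); first by rewrite lt_min r0 divr_gt0.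
  move=> h; rewrite subr0 lt_min => /andP[hr he].
  rewrite !normE -toCM toC_le.
  rewrite [X in modulus X](_ : _ = f (x + h) - f x - df h); last first.
    by rewrite !fctE /= opprD addrA [x + h]addrC.
  apply: le_trans (exp _ hr) _; rewrite expr2 mulrA ler_wpM2r ?modulus_ge0//.
  move: he; rewrite ltr_pdivlMr// mulrC => /ltW; apply: le_trans.
  by rewrite ler_wpM2r ?modulus_ge0// (le_trans (ler_norm _))// lerDl.
apply/diff_locallyP; rewrite (diff_unique Lc oE); split=> //.
Qed.

(** Each term at [x + h] is [g_n / (1 - b_n h)] with [b_n] linear and bounded
    by [modulus h / ρ] uniformly in [n].  Shifting the geometric series twice
    isolates the linear part and leaves a quadratic remainder. *)
Lemma differentiable_dsum_inv (R : realType) (V : normedModType (Cfield R))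
    (L : nat -> V -> Cfield R) (a c : nat -> Cfield R) (x : V) (ρ D : R) :
  0 < ρ -> (forall n b h k, L n (b *: h + k) = b * L n h + L n k) ->
  (forall n h, modulus h < ρ -> a n + L n (x + h) != 0) ->
  dominated (fun n => c n / (a n + L n x)) D ->
  differentiable (fun z => dsum (fun n => c n / (a n + L n z))) x.
Proof.
move=> ρ0 Llin nz gD.
have L0 n : L n 0 = 0.
  have := Llin n (-1) 0 0; rewrite scaler0 addr0 mulN1r addNr; exact.
have LZ n b h : L n (b *: h) = b * L n h by rewrite -[b *: h]addr0 Llin L0 addr0.
have LD n h k : L n (h + k) = L n h + L n k.
  by rewrite -[h in LHS]scale1r Llin mul1r.
pose g n := c n / (a n + L n x).
pose l n := a n + L n x.
have lN0 n : l n != 0.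
  by have := nz n 0; rewrite modulus0 addr0; apply.
pose b h n := - (L n h / l n).
have bh h n : modulus (b h n) <= modulus h / ρ.
  rewrite modulusN modulusM modulusV ler_pdivrMr ?modulus_gt0//.
  rewrite mulrAC ler_pdivlMr// [leRHS]mulrC.
  apply: (@nonvanishing_linear_le _ _ (L n)) => // k kρ.
  by rewrite /l -addrA -LD; exact: nz.
have gb h : dominated (fun n => g n * b h n) (D * (modulus h / ρ)).
  exact: dominatedM.
have D0 := dominated_ge0 gD.
apply: (@differentiable_of_expansion _ _ _ (fun h => dsum (fun n => g n * b h n))
  x (4 * (D / ρ) + 4 * (D / ρ ^+ 2 * 2)) (ρ / 2)).
- by rewrite divr_gt0.
- move=> e h k /=; rewrite [RHS]addrC -(dsum_linear e (gb k) (gb h)); congr dsum.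
  by apply/funext => n; rewrite /b Llin mulrDl; ring.
- move=> h; apply: le_trans (modulus_dsum (gb h)) _.
  have -> : 4 * (D * (modulus h / ρ)) = 4 * (D / ρ) * modulus h by ring.
  rewrite ler_wpM2r ?modulus_ge0// lerDl !mulr_ge0 ?invr_ge0 ?exprn_ge0//.
  exact: ltW.
move=> h hρ.
have h1 : modulus (1 : Cfield R) * (modulus h / ρ) <= 2^-1.
  by rewrite modulus1 mul1r ler_pdivrMr// mulrC ltW.
have -> : (fun n => c n / (a n + L n (x + h))) =
    (fun n => g n / (1 - 1 * b h n)).
  apply/funext => n; rewrite /g /b.
  have : a n + L n (x + h) != 0.
    by apply: nz; rewrite (lt_le_trans hρ)// ler_piMr// ?invf_le1 ?ler1n// ltW.
  rewrite LD addrA mul1r opprK -/(l n) => ne.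
  move: (lN0 n) ne; move: (l n) (L n h) => p e p0 pe0.
  by field; rewrite p0 pe0.
rewrite (dsum_geometric_shift gD (bh h) h1) (dsum_geometric_shift (gb h) (bh h) h1).
rewrite !mul1r.
have remainder (p q e : Cfield R) : p + (q + e) - p - q = e by ring.
rewrite remainder.
have gbb : dominated (fun n => g n * b h n * b h n)
    (D * (modulus h / ρ) * (modulus h / ρ)).
  exact: dominatedM.
apply: le_trans (modulus_dsum (dominated_geometric gbb (bh h) h1)) _.
have -> : 4 * (D * (modulus h / ρ) * (modulus h / ρ) * 2) =
   4 * (D / ρ ^+ 2 * 2) * modulus h ^+ 2.
  by field; rewrite gt_eqF.
rewrite ler_wpM2r ?exprn_ge0 ?modulus_ge0// lerDr !mulr_ge0 ?invr_ge0//.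
exact: ltW.
Qed.

Lemma derivable_line (R : realType) (V : normedModType (Cfield R))
    (F : V -> Cfield R) (q u : V) (z : Cfield R) :
  differentiable F (q + z *: u) -> derivable (fun z : Cfield R => F (q + z *: u)) z 1.
Proof.
move=> dF; apply/derivable1_diffP.
apply: (@differentiable_comp _ _ _ _ (fun z : Cfield R => q + z *: u) F) => //.
Qed.

(** * Connected components of open sets *)

Lemma continuous_segment (R : realType) (V : normedModType (Cfield R)) (x y : V) :
  continuous (fun t : R => x + toC t *: (y - x)).
Proof.
move=> t A /nbhs_modulusP[e e0 eA]; apply/nbhs_ballP.
have m0 : 0 < modulus (y - x) + 1 by rewrite ltr_wpDl// modulus_ge0.
exists (e / (modulus (y - x) + 1)); first by rewrite /= divr_gt0.
move=> u; rewrite -ball_normE /= ltr_pdivlMr// => tu; apply: eA.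
rewrite opprD addrACA subrr add0r -scalerBl modulusZ.
have -> : toC u - toC t = toC (u - t).
  rewrite [RHS]toCD; congr (_ + _).
  by apply/eqP; rewrite eq_complex /= oppr0 !eqxx.
rewrite modulus_toC distrC; apply: le_lt_trans tu; rewrite ler_wpM2l//.
by rewrite lerDl.
Qed.

(** Balls contain the real segments from their centre. *)
Lemma ball_in_connected_component (R : realType) (V : normedModType (Cfield R))
    (A : set V) (x y z : V) (r : R) :
  (forall w, modulus (w - x) < r -> A w) -> modulus (y - x) < r ->
  connected_component A z x -> connected_component A z y.
Proof.
move=> rA yr zx; apply: connected_component_trans zx _.
pose s (t : R) := x + toC t *: (y - x).
exists (s @` `[0, 1]); last first.
  by exists 1; rewrite /= ?in_itv/= ?lexx ?ler01// /s toC1 scale1r addrC subrK.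
split.
- by exists 0; rewrite /= ?in_itv/= ?lexx ?ler01// /s toC0 scale0r addr0.
- move=> _ [t t01 <-]; apply: rA; rewrite /s addrC addKr modulusZ modulus_toC.
  move: t01; rewrite /= in_itv/= => /andP[t0 t1]; rewrite ger0_norm//.
  by apply: le_lt_trans yr; rewrite ler_piMl ?modulus_ge0.
apply: connected_continuous_connected; first exact: segment_connected.
by apply: continuous_subspaceT; exact: continuous_segment.
Qed.

Lemma open_modulusP (R : realType) (V : normedModType (Cfield R)) (A : set V) (x : V) :
  open A -> A x -> exists2 r : R, 0 < r & forall w, modulus (w - x) < r -> A w.
Proof. by move=> Ao Ax; apply/nbhs_modulusP; exact: open_nbhs_nbhs. Qed.

Lemma component_open (R : realType) (V : normedModType (Cfield R)) (A : set V) (z : V) :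
  open A -> open (connected_component A z).
Proof.
move=> Ao; rewrite openE => x zx.
have [r r0 rA] := open_modulusP Ao (connected_component_sub zx).
apply/nbhs_modulusP; exists r => // w wx.
exact: (ball_in_connected_component rA wx zx).
Qed.

(** If no such point existed, [W] would be open and closed in [U]: a point of
    [U `&` Omega] adherent to a component of this open set belongs to it. *)
Lemma component_boundary_point (R : realType) (V : normedModType (Cfield R))
    (U Omega W : set V) :
  open Omega -> open U -> connected U -> U `&` ~` Omega !=set0 ->
  is_component (U `&` Omega) W ->
  exists ζ, [/\ U ζ, boundary Omega ζ & closure W ζ].
Proof.
move=> Oo Uo Uc [p [Up Op]] [x xA WE].
have Ao : open (U `&` Omega) by exact: openI.
have WA : W `<=` U `&` Omega by rewrite WE; exact: connected_component_sub.
have Wo : open W by rewrite WE; exact: component_open.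
apply: contrapT => no.
have WU : U `&` closure W `<=` W.
  move=> ζ [Uζ Wζ]; have [Oζ|nOζ] := pselect (Omega ζ).
    have [r r0 rA] := open_modulusP Ao (conj Uζ Oζ).
    have [y [Wy yr]] : W `&` [set w | modulus (w - ζ) < r] !=set0.
      by apply: Wζ; apply/nbhs_modulusP; exists r.
    have ζy : connected_component (U `&` Omega) ζ y.
      apply: (ball_in_connected_component rA yr).
      by apply: connected_component_refl.
    move: Wy; rewrite WE => xy.
    by apply: connected_component_trans xy _; exact: connected_component_sym.
  exfalso; apply: no; exists ζ; split=> //; split.
    by apply: (closure_subset _ Wζ) => w /WA[].
  by move/interior_subset.
suff WUE : W = U by apply: Op; have := WA p; rewrite WUE => /(_ Up)[].
apply: Uc.
- by exists x; rewrite WE; exact: connected_component_refl.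
- exists W => //; apply/seteqP; split=> [w Ww|w []//].
  by split=> //; have [] := WA _ Ww.
- exists (closure W); first exact: closed_closure.
  apply/seteqP; split=> [w Ww|]; last exact: WU.
  by split; [have [] := WA _ Ww|exact: subset_closure].
Qed.

(** * Coordinates, density and compactness in the complex space *)

Section ComplexSpace.
Variables (R : realType) (d : nat).
Notation C := (Cfield R).
Notation Cd := (Cspace R d).

Lemma modulus_row_entry (v : Cd) i : modulus (v 0 i : C) <= modulus v.
Proof.
rewrite -toC_le -!normE [`|v|]/Num.norm /= mx_normE.
rewrite -[leLHS]nngE num_le.
exact: (le_bigmax _ (fun i : 'I_1 * 'I_d => `|v i.1 i.2|%:nng) (0, i)).
Qed.

Lemma modulus_row_lt (v : Cd) (r : R) : 0 < r ->
  (forall i, modulus (v 0 i : C) < r) -> modulus v < r.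
Proof.
move=> r0 vr; have [->|] := eqVneq v 0; first by rewrite modulus0.
rewrite -normr_eq0 => /mx_norm_neq0[[i j] vE].
rewrite -toC_lt -normE [`|v|]vE /= (ord1 i) normE toC_lt.
exact: vr.
Qed.

Definition rational_point (q : 'rV[rat]_d * 'rV[rat]_d) : Cd :=
  \row_i (Complex (ratr (q.1 0 i)) (ratr (q.2 0 i)) : C).

Lemma rational_point_dense (z : Cd) (r : R) : 0 < r ->
  exists q, modulus (rational_point q - z) < r.
Proof.
move=> r0; have r20 : 0 < r / 2 by rewrite divr_gt0.
have near x : {q : rat | `|ratr q - x| < r / 2}.
  apply: cid; have /rat_in_itvoo[q] : x - r / 2 < x + r / 2 by lra.
  rewrite in_itv/= => /andP[? ?]; exists q; rewrite ltr_norml; lra.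
exists (\row_i sval (near (complex.Re (z 0 i))),
  \row_i sval (near (complex.Im (z 0 i)))).
apply: modulus_row_lt => // i; rewrite !mxE /=.
apply: le_lt_trans (modulus_le_ReIm _) _; rewrite [ltRHS]splitr.
by rewrite ltrD// ?ReB ?ImB /=; [exact: (svalP (near _))|exact: (svalP (near _))].
Qed.

Lemma dotmx_linear (v : Cd) (a : C) (h k : Cd) :
  dotmx (a *: h + k) v = a * dotmx h v + dotmx k v.
Proof. by rewrite !dotmxE mulmxDl -scalemxAl !mxE. Qed.

Lemma dotmx_self_neq0 (v : Cd) : v != 0 -> dotmx v v != 0.
Proof.
by move=> v0; rewrite gt_eqF//; exact: dotmx_is_dotmx.
Qed.

Lemma continuous_dotmx (a : C) (v : Cd) : continuous (fun z : Cd => a + dotmx z v).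
Proof.
pose K := \sum_i modulus ((v ^t*)%sesqui i 0 : C).
have K0 : 0 <= K by apply: sumr_ge0 => i _; exact: modulus_ge0.
have vK h : modulus (dotmx h v) <= K * modulus h.
  rewrite dotmxE mxE /K mulr_suml; elim/big_ind2: _ => [|? ? ? ? h1 h2|i _].
  - by rewrite modulus0.
  - by apply: le_trans (modulusD _ _) _; exact: lerD.
  by rewrite modulusM mulrC ler_wpM2l ?modulus_ge0// modulus_row_entry.
move=> z A /nbhs_CfieldP[e e0 eA]; apply: (nbhs_modulusP _ _).2.
exists (e / (K + 1)); first by rewrite divr_gt0// ltr_wpDl.
move=> w wz; apply: eA.
have -> : a + dotmx w v - (a + dotmx z v) = dotmx (w - z) v.
  have -> : w - z = -1 *: z + w by rewrite scaleN1r addrC.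
  rewrite (dotmx_linear v (-1) z w) mulN1r opprD addrACA subrr add0r.
  by rewrite addrC.
apply: le_lt_trans (vK _) _; move: wz.
rewrite ltr_pdivlMr ?ltr_wpDl// mulrC; apply: le_lt_trans.
by rewrite ler_wpM2r ?modulus_ge0// lerDl.
Qed.

Lemma compact_square (M : R) :
  compact [set z : C | `|complex.Re z| <= M /\ `|complex.Im z| <= M].
Proof.
have -> : [set z : C | `|complex.Re z| <= M /\ `|complex.Im z| <= M] =
    (fun p : R * R => Complex p.1 p.2 : C) @` (`[- M, M] `*` `[- M, M]).
  apply/seteqP; split=> [[x y] /= [xM yM]|_ [[x y] /= [xM yM] <-]].
    by exists (x, y) => //=; rewrite !in_itv/= -!ler_norml.
  by move: xM yM; rewrite /= !in_itv/= -!ler_norml.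
apply: continuous_compact; last by apply: compact_setX; exact: segment_compact.
apply: continuous_subspaceT => p.
by apply: (@continuous_Complex _ _ fst snd); [exact: cvg_fst|exact: cvg_snd].
Qed.

(** The image of the compact set [closure V] is closed and misses 0. *)
Lemma bounded_away_from_0 (V : set Cd) (l : Cd -> C) :
  bounded_set V -> continuous l -> (forall z, closure V z -> l z != 0) ->
  exists2 η : R, 0 < η & forall z, V z -> η <= modulus (l z).
Proof.
move=> [M [Mreal VM]] lc l0.
have [k kE] := complex_realP _ Mreal.
have sqc : compact [set v : Cd | forall i, 
    `|complex.Re (v 0 i)| <= k + 1 /\ `|complex.Im (v 0 i)| <= k + 1].
  apply: (@rV_compact C d (fun=> [set z : C | `|complex.Re z| <= k + 1 /\
     `|complex.Im z| <= k + 1])) => _.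
  exact: compact_square.
have Hd : hausdorff_space Cd by exact: norm_hausdorff.
have cV : compact (closure V).
  apply: (subclosed_compact _ sqc); first exact: closed_closure.
  have /closure_id -> := compact_closed Hd sqc.
  apply: closure_subset => v Vv i.
  have vk : modulus v <= k + 1.
    rewrite -toC_le -normE; apply: VM => //.
    by rewrite kE [ltRHS]toCD ltrDl toC1 ltr01.
  split; apply: le_trans vk; apply: le_trans (modulus_row_entry _ i).
    exact: Re_le_modulus.
  exact: Im_le_modulus.
have cl : closed (l @` closure V).
  apply: compact_closed; first exact: norm_hausdorff.
  by apply: continuous_compact => //; exact: continuous_subspaceT.
have : nbhs (0 : C) (~` (l @` closure V)).
  apply: open_nbhs_nbhs; split; first exact: closed_openC.
  by move=> [z Vz lz]; have := l0 z Vz; rewrite lz eqxx.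
move=> /nbhs_CfieldP[η η0 ηP]; exists η => // z Vz; rewrite leNgt; apply/negP => lt.
by apply: (ηP (l z)); rewrite ?subr0//; exists z => //; exact: subset_closure.
Qed.

End ComplexSpace.

(** * Functions singular near a boundary point *)

Section SingularFunctions.
Variables (R : realType) (d : nat) (Omega V : set (Cspace R d)).
Notation C := (Cfield R).
Notation Cd := (Cspace R d).

(** A triple [(a, c, v)] encodes the function [c / (a + <z, v>)], whose poles
    form the hyperplane [a + <z, v> = 0]. *)
Definition affine (s : C * C * Cd) (z : Cd) : C := s.1.1 + dotmx z s.2.

Definition reciprocal (s : C * C * Cd) (z : Cd) : C := s.1.2 / affine s z.

Definition admissible (s : C * C * Cd) := [/\
  forall z, closure Omega z -> affine s z != 0,
  forall z ρ, 0 < ρ -> (forall w, modulus (w - z) < ρ -> Omega w) ->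
    modulus (reciprocal s z) <= ρ^-1 &
  forall z, V z -> modulus (reciprocal s z) <= 1].

(** The zero function is attached to the indices without a boundary point in
    reach. *)
Lemma admissible_trivial : admissible (1, 0, 0).
Proof.
have a1 z : affine (1, 0, 0) z = 1.
  by rewrite /affine /= dotmxE trmx0 map_mx0 mulmx0 mxE addr0.
split=> [z _|z ρ ρ0 _|z _]; rewrite ?a1 ?oner_neq0// /reciprocal /= mul0r modulus0//.
by rewrite invr_ge0 ltW.
Qed.

Lemma dotmxZ (v : Cd) (a : C) (h : Cd) : dotmx (a *: h) v = a * dotmx h v.
Proof. by rewrite !dotmxE -scalemxAl !mxE. Qed.

Lemma affineD s (z h : Cd) : affine s (z + h) = affine s z + dotmx h s.2.
Proof.
rewrite /affine; have -> : z + h = 1 *: z + h by rewrite scale1r.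
by rewrite (dotmx_linear s.2 1 z h) mul1r addrA.
Qed.

(** The scaling constant is the smaller of a lower bound of the denominator on
    [V] and of the ratio [|<v, v>| / |v|]; having no zero in a ball of radius
    [ρ] inside [Omega], the denominator is at least [ρ |<v, v>| / |v|] at its
    centre. *)
Lemma exists_singular_function (q : Cd) (σ : R) (ζ : Cd) :
  star_condition Omega -> bounded_set V -> V `<=` Omega ->
  boundary Omega ζ -> modulus (ζ - q) < σ ->
  exists s w, [/\ admissible s, s.1.2 != 0, modulus (w - q) < σ & affine s w = 0].
Proof.
move=> star Vb VO bζ ζσ.
have : nbhs ζ [set w | modulus (w - q) < σ].
  apply/nbhs_modulusP; exists (σ - modulus (ζ - q)); first by rewrite subr_gt0.
  move=> w; rewrite ltrBrDr; apply: le_lt_trans.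
  by have := modulusD (w - ζ) (ζ - q); rewrite addrA subrK.
move=> /(star ζ bζ)[w [wσ _ [v [v0 disj]]]].
have nz z : closure Omega z -> - dotmx w v + dotmx z v != 0.
  move=> Oz; apply/eqP => e; suff : (hyperplane w v `&` closure Omega) z.
    by rewrite disj.
  split; last exact: Oz.
  by apply: subr0_eq; rewrite addrC.
have [η η0 ηP] : exists2 η : R, 0 < η & forall z, V z ->
    η <= modulus (- dotmx w v + dotmx z v : C).
  apply: bounded_away_from_0 => //; first exact: continuous_dotmx.
  by move=> z Vz; apply: nz; exact: (closure_subset VO).
pose κ := modulus (dotmx v v : C) / modulus v.
have vp : 0 < modulus v by rewrite modulus_gt0.
have κ0 : 0 < κ by rewrite divr_gt0// modulus_gt0 dotmx_self_neq0.
have m0 : 0 < Num.min η κ by rewrite lt_min η0.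
exists (- dotmx w v : C, toC (Num.min η κ), v), w; split=> //; last 1 first.
- by rewrite /affine /= addNr.
- split=> [z /nz//|z ρ ρ0 ball|z Vz]; rewrite /reciprocal /= modulusM modulusV;
    rewrite modulus_toC gtr0_norm// ler_pdivrMr.
  + have := @nonvanishing_linear_le _ Cd (fun h => dotmx h v)
      (affine (- dotmx w v, 0, v) z) ρ.
    have Oz : Omega z by apply: ball; rewrite subrr modulus0.
    move=> /(_ (dotmxZ v)) /(_ _ v); set A := affine _ _ => H.
    have {}H : modulus (dotmx v v : C) * ρ <= modulus A * modulus v.
      apply: H => h hρ; rewrite -affineD; apply: nz; apply: subset_closure.
      by apply: ball; rewrite addrC addKr.
    rewrite mulrC ler_pdivlMr//.
    apply: (@le_trans _ _ (κ * ρ)).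
      by rewrite ler_wpM2r ?(ltW ρ0)// ge_min lexx orbT.
    by rewrite /κ mulrAC ler_pdivrMr.
  + rewrite modulus_gt0; apply: nz; apply: subset_closure.
    by apply: ball; rewrite subrr modulus0.
  + by rewrite mul1r (le_trans _ (ηP z Vz))// ge_min lexx.
  + by rewrite (lt_le_trans η0)//; exact: ηP.
- by rewrite -modulus_gt0 modulus_toC gtr0_norm.
Qed.
End SingularFunctions.

(** * Weighted series of singular functions *)

Section PoleSeries.
Variables (R : realType) (d : nat) (Omega V : set (Cspace R d)).
Notation C := (Cfield R).
Notation Cd := (Cspace R d).
Variable s : nat -> C * C * Cd.
Hypothesis s_adm : forall k, admissible Omega V (s k).

(** Any map [nat -> nat] with infinite fibres would do. *)
Definition kind (n : nat) := logn 2 n.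

Lemma kind_infinitely_often k N : exists2 n, (N <= n)%N & kind n = k.
Proof.
exists (2 ^ k * (2 * N).+1)%N.
  apply: (@leq_trans (2 * N).+1); first by rewrite mul2n -addnn -addnS leq_addr.
  by rewrite leq_pmull// expn_gt0.
rewrite /kind lognM ?expn_gt0// pfactorK// [logn 2 (2 * N).+1](_ : _ = 0%N) ?addn0//.
by apply/eqP; rewrite lognE /= dvdn2 /= mul2n odd_double.
Qed.

Definition weight (n : nat) : C := toC (2^-1 ^+ n) * (s (kind n)).1.2.

Definition term (n : nat) (z : Cd) : C := weight n / affine (s (kind n)) z.

Definition subseries (S : nat -> bool) (z : Cd) : C :=
  dsum (fun n => (S n)%:R * weight n / affine (s (kind n)) z).

Lemma modulus_bit (b : bool) (x : C) : modulus (b%:R * x) <= modulus x.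
Proof. by case: b; rewrite ?mul1r// mul0r modulus0 modulus_ge0. Qed.

Lemma termE n z : term n z = toC (2^-1 ^+ n) * reciprocal (s (kind n)) z.
Proof. by rewrite /term /weight /reciprocal mulrA. Qed.

Lemma dominated_term z (B : R) :
  (forall k, modulus (reciprocal (s k) z) <= B) -> dominated (term^~ z) B.
Proof.
move=> sB n; rewrite termE modulusM modulus_toC ger0_norm ?exprn_ge0//.
by rewrite mulrC ler_wpM2r// exprn_ge0.
Qed.

Lemma dominated_subseries (S : nat -> bool) z (B : R) :
  (forall k, modulus (reciprocal (s k) z) <= B) ->
  dominated (fun n => (S n)%:R * weight n / affine (s (kind n)) z) B.
Proof.
move=> sB n; rewrite -mulrA; apply: le_trans (modulus_bit _ _) _.
exact: dominated_term.
Qed.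

Lemma subseries_holomorphic_bounded S : open Omega ->
  holomorphic_bounded_on Omega V (subseries S).
Proof.
move=> Oo; split.
  move=> z Oz; have [ρ ρ0 ball] := open_modulusP Oo Oz.
  have h : modulus (0 : Cd) < ρ by rewrite modulus0.
  apply: (@differentiable_dsum_inv _ Cd (fun n h => dotmx h (s (kind n)).2)
    (fun n => (s (kind n)).1.1) (fun n => (S n)%:R * weight n) z ρ ρ^-1) => //.
  - by move=> n a k l; exact: dotmx_linear.
  - move=> n k kρ; have [nz _ _] := s_adm (kind n).
    by apply: nz; apply: subset_closure; apply: ball; rewrite addrC addKr.
  - by apply: dominated_subseries => k; have [_ h' _] := s_adm k; exact: h'.
exists (toC 4); split; first by apply/complex_realP; exists 4.
move=> x x4 z Vz /=; rewrite (le_trans _ (ltW x4))// normE toC_le.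
rewrite -[leRHS]mulr1; apply: modulus_dsum; apply: dominated_subseries => k.
by have [_ _] := s_adm k; exact.
Qed.

(** On the line [q + z u] the [n]-th term is [term n q / (1 - z * slope q u n)].
    For [q] in [Omega] the slope is 1 exactly when [q + u] is a pole. *)
Definition slope (q u : Cd) (n : nat) : C :=
  - (dotmx u (s (kind n)).2 / affine (s (kind n)) q).

Lemma slope_le (q u : Cd) n (ρ : R) :
  0 < ρ -> (forall w, modulus (w - q) < ρ -> Omega w) ->
  modulus (slope q u n) <= modulus u / ρ.
Proof.
move=> ρ0 ball.
have nz w : modulus (w - q) < ρ -> affine (s (kind n)) w != 0.
  move=> /ball Ow; have [h _ _] := s_adm (kind n); apply: h.
  exact: subset_closure.
rewrite modulusN modulusM modulusV ler_pdivrMr; last first.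
  by rewrite modulus_gt0 nz// subrr modulus0.
rewrite mulrAC ler_pdivlMr// [leRHS]mulrC.
apply: (@nonvanishing_linear_le _ Cd (fun h => dotmx h (s (kind n)).2)).
  by move=> a h; exact: dotmxZ.
by move=> h hρ; rewrite -affineD nz// addrC addKr.
Qed.

(** The left-hand side is the [m]-th Taylor coefficient at [z = 0] of the
    restriction of [subseries S], and thus of [F], to the line [q + z u]. *)
Lemma subseries_taylor_le (S : nat -> bool) (F : Cd -> C) (q u : Cd) (ρ M : R) m :
  0 < ρ -> (forall w, modulus (w - q) < ρ -> Omega w /\ F w = subseries S w) ->
  (forall z : C, modulus z <= 4 ->
    differentiable F (q + z *: u) /\ modulus (F (q + z *: u)) <= M) ->
  modulus (dsum (fun n => (S n)%:R * (term n q * slope q u n ^+ m)))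
    <= M * 2^-1 ^+ m.
Proof.
move=> ρ0 FS FM.
have ballO w : modulus (w - q) < ρ -> Omega w by move=> /FS[].
have nz k w : modulus (w - q) < ρ -> affine (s k) w != 0.
  by move=> /ballO Ow; have [h _ _] := s_adm k; apply: h; exact: subset_closure.
have qq : modulus (q - q) < ρ by rewrite subrr modulus0.
have dD : dominated (fun n => (S n)%:R * weight n / affine (s (kind n)) q) ρ^-1.
  by apply: dominated_subseries => k; have [_ h _] := s_adm k; exact: h.
have bβ n := slope_le u n ρ0 ballO.
under [X in dsum X]eq_fun do rewrite mulrA [_ * term _ _]mulrA.
apply: (taylor_coefficient_le (h := fun z : C => F (q + z *: u)) _ dD bβ).
- by move=> z /andP[_ /FM[dF _]]; exact: derivable_line.
- by move=> z z4; apply: (FM _ _).2; rewrite z4.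
move=> z zβ.
have zu : modulus (z *: u) < ρ.
  rewrite modulusZ; move: zβ; rewrite mulrA ler_pdivrMr// => /le_lt_trans; apply.
  by rewrite gtr_pMl// invf_lt1 ?ltr1n.
have zq : modulus (q + z *: u - q) < ρ by rewrite addrC addKr.
have [_ ->] := FS _ zq; congr dsum; apply/funext => n.
have := nz (kind n) _ zq; have := nz (kind n) _ qq.
rewrite affineD dotmxZ /slope.
move: (affine _ _) (dotmx _ _) => A D A0 AD.
by field; rewrite A0 mulrN opprK.
Qed.

End PoleSeries.

(** * Existence of a non-extendable function *)

Theorem theorem4p2 (R : realType) (d : nat) (d_gt0 : (0 < d)%N)
    (Omega V : set (Cspace R d)) :
  domain Omega -> star_condition Omega ->
  open V -> bounded_set V -> V `<=` Omega ->
  domain_of_holomorphy Omega (holomorphic_bounded_on Omega V).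
Proof.
move=> [Oo _ _] star _ Vb VO.
pose data k : ('rV[rat]_d * 'rV[rat]_d) * nat := odflt (0, 0, 0%N) (unpickle k).
pose q k : Cspace R d := rational_point R (data k).1.
pose σ k : R := (data k).2.+1%:R^-1.
pose I k := Omega (q k) /\ exists2 ζ, boundary Omega ζ & modulus (ζ - q k) < σ k.
(* [I k] says that the pair [(q k, σ k)] has a boundary point in reach; the
   other indices are filled with the zero function. *)
have ex k : exists s w, admissible Omega V s /\ (I k ->
    [/\ s.1.2 != 0, modulus (w - q k) < σ k & affine s w = 0]).
  have [[Oq [ζ bζ ζσ]]|nI] := pselect (I k).
    have [s [w [s1 s2 s3 s4]]] := exists_singular_function star Vb VO bζ ζσ.
    by exists s, w.
  by exists (1, 0, 0), 0; split=> //; exact: admissible_trivial.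
pose s k := sval (cid (ex k)).
have exw k : exists w, admissible Omega V (s k) /\ (I k ->
    [/\ (s k).1.2 != 0, modulus (w - q k) < σ k & affine (s k) w = 0]).
  exact: (svalP (cid (ex k))).
pose w k := sval (cid (exw k)).
have sP k : admissible Omega V (s k) by have [] := svalP (cid (exw k)).
have wP k : I k ->
    [/\ (s k).1.2 != 0, modulus (w k - q k) < σ k & affine (s k) (w k) = 0].
  by have [_] := svalP (cid (exw k)).
pose u k := w k - q k.
(* the [m]-th Taylor coefficient of the [n]-th term on the [k]-th line,
   rescaled so that an extension would keep the sums bounded in [m] *)
pose t k m n : Cfield R := toC (2 ^+ m) * (term s n (q k) * slope s (q k) (u k) n ^+ m).
have affine_q k l : Omega (q l) -> affine (s k) (q l) != 0.
  by move=> Oq; have [h _ _] := sP k; apply: h; exact: subset_closure.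
have coefB k m : I k -> exists B : R,
    dominated (fun n => term s n (q k) * slope s (q k) (u k) n ^+ m) B.
  move=> [Oq _]; have [ρ ρ0 ball] := open_modulusP Oo Oq.
  exists (ρ^-1 * (modulus (u k) / ρ) ^+ m); apply: dominatedM.
    by apply: dominated_term => l; have [_ h _] := sP l; exact: h.
  move=> n; rewrite modulusX lerXn2r ?nnegrE ?modulus_ge0//.
    by rewrite divr_ge0 ?modulus_ge0// ltW.
  exact: (slope_le sP).
have [||S SP] := @exists_bits_unbounded R I t.
- move=> k m /(coefB k m)[B BP]; exists (2 ^+ m * B) => n.
  rewrite /t modulusM modulus_toC ger0_norm ?exprn_ge0// -mulrA.
  by rewrite ler_wpM2l ?exprn_ge0.
- move=> k Ik N; have [n Nn kn] := kind_infinitely_often k N.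
  exists n => // x; have [c0 _ wE] := wP k Ik; have [Oq _] := Ik.
  have slope1 : slope s (q k) (u k) n = 1.
    rewrite /slope kn; have := affineD (s k) (q k) (u k).
    rewrite /u addrC subrK wE => /esym/eqP; rewrite addrC addr_eq0 => /eqP ->.
    by rewrite mulNr opprK divff// affine_q.
  have t0 : 0 < modulus (term s n (q k)).
    rewrite modulus_gt0 /term /weight kn !mulf_neq0 ?invr_eq0 ?affine_q//.
    by rewrite -modulus_gt0 modulus_toC normr_gt0 expf_neq0.
  have [m] := exists_half_pow_lt `|x| t0; move=> /(_ m (leqnn m)) xm.
  exists m; rewrite /t slope1 expr1n mulr1 modulusM modulus_toC.
  apply: le_lt_trans (ler_norm x) _.
  rewrite [`|2 ^+ m|]gtr0_norm ?exprn_gt0//.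
  by move: xm; rewrite exprVn ltr_pdivrMr ?exprn_gt0// mulrC.
exists (subseries s S); split; first exact: subseries_holomorphic_bounded.
move=> [U [F [W [[Uo Uc] [_ UnO] Fh Wc WF]]]].
have [ζ [Uζ bζ Wζ]] := component_boundary_point Oo Uo Uc UnO Wc.
have WO : W `<=` U `&` Omega.
  by have [x _ ->] := Wc; exact: connected_component_sub.
have Wo : open W by have [x _ ->] := Wc; apply: component_open; exact: openI.
have [r r0 [rU rM]] : exists2 r : R, 0 < r & (forall y, modulus (y - ζ) < r -> U y) /\
    (forall y, modulus (y - ζ) < r -> modulus (F y) <= modulus (F ζ) + 1).
  have [r1 r10 U1] := open_modulusP Uo Uζ.
  have : nbhs (F ζ) [set y | modulus (y - F ζ) < 1].
    by apply/nbhs_CfieldP; exists 1.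
  move=> /(differentiable_continuous (Fh ζ Uζ))/nbhs_modulusP[r2 r20 F2].
  exists (Num.min r1 r2); first by rewrite lt_min r10.
  split=> y; rewrite lt_min => /andP[y1 y2]; first exact: U1.
  have := modulusD (F y - F ζ) (F ζ); rewrite subrK => /le_trans; apply.
  by rewrite addrC lerD2l ltW// F2.
(* [4 σ] for the disc [|z| <= 4] on the line, and one more [σ] for the distance
   from its centre [q] to [ζ] *)
have [j jr] : exists j : nat, j.+1%:R^-1 < r / 5.
  have r5 : 0 < r / 5 by rewrite divr_gt0.
  exists (Num.bound (r / 5)^-1); rewrite invf_plt ?posrE//.
  have := archi_boundP (ltW (etrans (invr_gt0 _) r5)) => /lt_trans; apply.
  by rewrite ltr_nat.
pose σj : R := j.+1%:R^-1.
have [p [Wp pζ]] : exists p, W (rational_point R p) /\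
    modulus (rational_point R p - ζ) < σj.
  have [y [Wy yζ]] : W `&` [set y | modulus (y - ζ) < σj] !=set0.
    by apply: Wζ; apply/nbhs_modulusP; exists σj => //; rewrite invr_gt0.
  have [r1 r10 W1] := open_modulusP Wo Wy.
  have e0 : 0 < Num.min r1 (σj - modulus (y - ζ)) by rewrite lt_min r10 subr_gt0.
  have [p] := rational_point_dense y e0; rewrite lt_min => /andP[p1 p2].
  exists p; split; first exact: W1.
  have := modulusD (rational_point R p - y) (y - ζ).
  by rewrite addrA subrK => /le_lt_trans; apply; rewrite -ltrBrDr.
pose k := pickle (p, j).
have dk : data k = (p, j) by rewrite /data pickleK.
have qE : q k = rational_point R p by rewrite /q dk.
have σE : σ k = σj by rewrite /σ dk.
have Wq : W (q k) by rewrite qE.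
have qζ : modulus (q k - ζ) < σj by rewrite qE.
have Ik : I k.
  split; first by have [] := WO _ Wq.
  by exists ζ => //; rewrite σE modulus_distC.
have [c0 wσ wE] := wP k Ik.
have [ρ ρ0 ball] := open_modulusP Wo Wq.
have [m] := SP k Ik (modulus (F ζ) + 1); apply/negP; rewrite -leNgt.
have -> : (fun n => (S n)%:R * t k m n) = (fun n => toC (2 ^+ m) *
   ((S n)%:R * (term s n (q k) * slope s (q k) (u k) n ^+ m))).
  by apply/funext => n; rewrite /t mulrCA.
have OF y : modulus (y - q k) < ρ -> Omega y /\ F y = subseries s S y.
  by move=> /ball Wy; split; [have [] := WO _ Wy|apply: WF; rewrite inE].
have FM (z : Cfield R) : modulus z <= 4 -> differentiable F (q k + z *: u k) /\
    modulus (F (q k + z *: u k)) <= modulus (F ζ) + 1.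
  move=> z4; have zr : modulus (q k + z *: u k - ζ) < r.
    have -> : q k + z *: u k - ζ = (q k - ζ) + z *: u k by rewrite addrAC.
    apply: le_lt_trans (modulusD _ _) _; rewrite modulusZ.
    have uσ : modulus (u k) < σj by rewrite -σE.
    have : modulus z * modulus (u k) <= 4 * σj.
      by rewrite ler_pM ?modulus_ge0// ltW.
    by move: jr qζ; rewrite -/σj; lra.
  by split; [apply: Fh; exact: rU|exact: rM].
have taylor := subseries_taylor_le sP m ρ0 OF FM.
have [B BP] := coefB k m Ik.
have SBP : dominated (fun n =>
    (S n)%:R * (term s n (q k) * slope s (q k) (u k) n ^+ m)) B.
  by move=> n; exact: le_trans (modulus_bit _ _) (BP n).
rewrite (dsumM _ SBP) modulusM modulus_toC ger0_norm ?exprn_ge0//.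
apply: le_trans (ler_wpM2l _ taylor) _; first exact: exprn_ge0.
by rewrite mulrCA -exprMn divff// expr1n mulr1.
Qed.
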